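(* Let $G$ be a clean 2-dd all of whose alternating cycles have exactly 6 arcs, and suppose $G$ is odd, connected and not 2-splittable. Let $F$ be a subgraph of $G$ with exactly 3 alternating cycles and exactly $s$ saturated vertices, and suppose that $F$ does not contain a subgraph with exactly 2 alternating cycles and more than 2 saturated vertices. If $s>4$, then we can either collapse $F$ entirely, or replace $F$ with a single alternating cycle with 6 arcs, or replace $F$ with a 2-digraph consisting of a pair of alternating cycles with 6 arcs each, so as to obtain an odd 2-dd $G'$, all of whose alternating cycles have exactly 6 arcs, which is H-equivalent to $G$.
   Context: A 2-digraph is a finite digraph in which each vertex has (in-degree, out-degree) equal to $(0,2)$ (an entry vertex), $(2,0)$ (an exit vertex) or $(2,2)$ (a saturated vertex). A 2-dd is a 2-digraph all of whose vertices are saturated. Connected means that the underlying undirected graph is connected. An alternating cycle (AC) is a sequence of $2r$ distinct arcs $(e_0,\dots,e_{2r-1})$ such that $e_i$ and $e_{i+1}$ (indices mod $2r$) have a common end-vertex if $i$ is even and a common start-vertex if $i$ is odd; its forward arcs are the $e_i$ with $i$ even and its backward arcs those with $i$ odd. The arc set of a 2-digraph is uniquely partitioned into ACs. An AC is clean if no vertex is both the start-vertex of one of its arcs and the end-vertex of one of its arcs; a 2-digraph is clean if all its ACs are clean. A subgraph of a 2-digraph means the 2-digraph induced by a non-empty set of its ACs (all arcs of these ACs and their end-points). Entry, exit and saturated vertices of a subgraph $F$ are with respect to degrees in $F$. The complement $\overline{F}$ of a subgraph $F$ of $G$ is the subgraph induced by the remaining ACs of $G$; the entry vertices of $F$ are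 exactly the exit vertices of $\overline{F}$ and vice versa. A factor of a 2-digraph is a spanning subgraph which, for every AC, contains either all its forward arcs and none of its backward arcs, or vice versa; it is a disjoint union of directed cycles and directed paths from entry to exit vertices. A factor is open if it contains no cycle. The route of a factor is the bijection from entry vertices to exit vertices sending each entry vertex to the end of the path starting there; a route is open if it is the route of at least one open factor. A 2-dd is odd if every one of its factors has an odd number of cycles. It is Hamiltonian if it has a directed cycle through all vertices. Two 2-dds are H-equivalent if both are Hamiltonian or both are non-Hamiltonian. Splitting a saturated vertex $v$ means replacing it by two vertices $v^{in},v^{out}$, the two in-arcs of $v$ becoming in-arcs of $v^{in}$ and the two out-arcs becoming out-arcs of $v^{out}$. $G$ is 2-splittable if there is a set of 2 saturated vertices such that splitting both increases the number of connected components. Collapsing $F$: for an open route $r$ of $F$, form a 2-dd from $\overline{F}$ by identifying each entry vertex $u$ of $F$ with the exit vertex $r(u)$ of $F$ (arcs and saturated vertices of $F$ are deleted). Replacing $F$ by a 2-digraph $F'$ with the same number of exit vertices as $F$: form a 2-dd from the disjoint union of $\overline{F}$ and $F'$ by identifying the exit vertices of $\overline{F}$ with the entry vertices of $F'$ via some bijection and the exit vertices of $F'$ with the entry vertices of $\overline{F}$ via some bijection. The claim asserts that some such choice produces a $G'$ as stated. *)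

(* Defs.v *)
From HB Require Import structures.
From mathcomp Require Import all_boot.

Set Implicit Arguments.
Unset Strict Implicit.
Unset Printing Implicit Defensive.

(* Loops and parallel arcs are allowed: identifying vertices may create loops,
   and an alternating cycle with two arcs is a pair of parallel arcs. *)
Record digraph := Digraph {
  vertex :> finType;
  darc : finType;
  src : darc -> vertex;
  tgt : darc -> vertex
}.

Arguments src {d} e.
Arguments tgt {d} e.

Section Degrees.
Variable G : digraph.

Definition indeg (v : G) := #|[set e : darc G | tgt e == v]|.
Definition outdeg (v : G) := #|[set e : darc G | src e == v]|.

Definition entries : {set G} := [set v | (indeg v == 0) && (outdeg v == 2)].
Definition exits : {set G} := [set v | (indeg v == 2) && (outdeg v == 0)].
Definition saturated : {set G} := [set v | (indeg v == 2) && (outdeg v == 2)].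

Definition is_2digraph : Prop :=
  forall v : G, [|| v \in entries, v \in exits | v \in saturated].

Definition is_2dd : Prop := forall v : G, v \in saturated.

End Degrees.

Section Connectivity.
Variable G : digraph.

Definition undirected : rel G := fun u v =>
  [exists e : darc G, ((src e == u) && (tgt e == v))
                  || ((src e == v) && (tgt e == u))].

Definition connected : Prop := forall u v : G, connect undirected u v.

Definition num_components := n_comp undirected predT.

End Connectivity.

Section AlternatingCycles.
Variable G : digraph.

(* [ordS] is the cyclic successor, so indices are taken modulo [n]. *)
Definition alternating n (c : n.-tuple (darc G)) : bool :=
  [&& 0 < n, ~~ odd n, uniq c
    & [forall i : 'I_n,
        if odd i then src (tnth c i) == src (tnth c (ordS i))
        else tgt (tnth c i) == tgt (tnth c (ordS i))]].

Definition forward n (c : n.-tuple (darc G)) : {set darc G} :=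
  [set tnth c i | i : 'I_n & ~~ odd i].
Definition backward n (c : n.-tuple (darc G)) : {set darc G} :=
  [set tnth c i | i : 'I_n & odd i].

(* The alternating cycles of [G], each identified with its set of arcs (the
   same alternating cycle is traversed by several sequences). *)
Definition ACs : {set {set darc G}} :=
  [set A : {set darc G} |
    [exists c : #|A|.-tuple (darc G), alternating c && (A == [set e in c])]].

Definition all_ACs_size n : Prop := forall A, A \in ACs -> #|A| = n.

Definition clean_AC (A : {set darc G}) : Prop :=
  forall e f, e \in A -> f \in A -> src e <> tgt f.

Definition clean : Prop := forall A, A \in ACs -> clean_AC A.

End AlternatingCycles.

Section Subgraphs.
Variables (G : digraph) (E : {set darc G}).

Definition incident (v : G) : bool :=
  [exists e in E, (src e == v) || (tgt e == v)].

Lemma incident_src (e : {e : darc G | e \in E}) : incident (src (val e)).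
Proof. by apply/exists_inP; exists (val e); [exact: valP | rewrite eqxx]. Qed.

Lemma incident_tgt (e : {e : darc G | e \in E}) : incident (tgt (val e)).
Proof.
by apply/exists_inP; exists (val e); [exact: valP | rewrite eqxx orbT].
Qed.

Definition arc_induced : digraph :=
  @Digraph {v : G | incident v} {e : darc G | e \in E}
    (fun e => Sub (src (val e)) (incident_src e))
    (fun e => Sub (tgt (val e)) (incident_tgt e)).

End Subgraphs.

(* A subgraph is given by its non-empty set of alternating cycles; containment
   of subgraphs is inclusion of these sets, and [subdigraph F] is the subgraph
   as a digraph of its own, so that degrees are taken in the subgraph. *)
Definition is_subgraph (G : digraph) (F : {set {set darc G}}) : Prop :=
  F != set0 /\ F \subset ACs G.

Definition subdigraph (G : digraph) (F : {set {set darc G}}) : digraph :=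
  arc_induced (cover F).

Definition complement (G : digraph) (F : {set {set darc G}}) : digraph :=
  subdigraph (ACs G :\: F).

Section Factors.
Variable G : digraph.

(* A factor is given by its set of arcs. *)
Definition is_factor (X : {set darc G}) : Prop :=
  forall n (c : n.-tuple (darc G)), alternating c ->
    (forward c \subset X /\ [disjoint backward c & X]) \/
    (backward c \subset X /\ [disjoint forward c & X]).

Definition dicycle (c : seq (darc G)) : bool :=
  [&& c != [::], cycle [rel e f | tgt e == src f] c & uniq (map src c)].

Definition cycles (X : {set darc G}) : {set {set darc G}} :=
  [set C : {set darc G} | (C \subset X) &&
    [exists c : #|C|.-tuple (darc G), dicycle c && (C == [set e in c])]].

Definition open_factor (X : {set darc G}) : Prop :=
  is_factor X /\ cycles X = set0.

Definition odd_2dd : Prop :=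
  is_2dd G /\ forall X, is_factor X -> odd #|cycles X|.

Definition hamiltonian : Prop :=
  exists2 c : seq (darc G), dicycle c & forall v : G, v \in map src c.

Definition step (X : {set darc G}) : rel G := fun u v =>
  [exists e in X, (src e == u) && (tgt e == v)].

(* In a factor every vertex has in- and out-degree at most 1, so the exit
   vertex that is reached from an entry vertex is the end of its path. *)
Definition is_route (X : {set darc G})
    (r : {u | u \in entries G} -> {w | w \in exits G}) : Prop :=
  bijective r /\ forall u, connect (step X) (val u) (val (r u)).

Definition open_route (r : {u | u \in entries G} -> {w | w \in exits G}) :=
  exists2 X, open_factor X & is_route X r.

End Factors.

Definition H_equivalent (G G' : digraph) : Prop :=
  hamiltonian G <-> hamiltonian G'.

Section Splitting.
Variables (G : digraph) (W : {set G}).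

(* For [v] in [W], [(v, false)] is v^in and [(v, true)] is v^out; for [v] not
   in [W], [(v, false)] is [v] itself. *)
Definition split_vertex := {p : G * bool | p.2 ==> (p.1 \in W)}.

Lemma split_src_proof (v : G) : (v, v \in W).2 ==> ((v, v \in W).1 \in W).
Proof. exact: implybb. Qed.

Definition split_at : digraph :=
  @Digraph split_vertex (darc G)
    (fun e => Sub (src e, src e \in W) (split_src_proof (src e)))
    (fun e => Sub (tgt e, false) isT).

End Splitting.

Definition two_splittable (G : digraph) : Prop :=
  exists W : {set G}, [/\ #|W| = 2, W \subset saturated G
    & num_components G < num_components (split_at W)].

Section Identification.
Variables (H : digraph) (glue : rel H).

(* Quotient of the vertices by the equivalence generated by [glue]; a class is
   represented by its canonical element. *)
Definition glue_sym : rel H := fun x y => glue x y || glue y x.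

Lemma glue_sym_connect : connect_sym glue_sym.
Proof. by apply: sym_connect_sym => x y; rewrite /glue_sym orbC. Qed.

Definition glued_vertex := {x : H | x \in roots glue_sym}.

Definition glue_class (x : H) : glued_vertex :=
  Sub (root glue_sym x) (roots_root glue_sym_connect x).

Definition identify : digraph :=
  @Digraph glued_vertex (darc H)
    (fun e => glue_class (src e)) (fun e => glue_class (tgt e)).

End Identification.

(* Entry and exit vertices of [subdigraph F] are matched with vertices of
   [complement F] through the underlying vertices of [G]. *)
Definition collapse (G : digraph) (F : {set {set darc G}})
    (r : {u | u \in entries (subdigraph F)} ->
         {w | w \in exits (subdigraph F)}) : digraph :=
  @identify (complement F) (fun x y =>
    [exists u, (val x == val (val u)) && (val y == val (val (r u)))]).

Definition disjoint_union (H K : digraph) : digraph :=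
  @Digraph (H + K)%type (darc H + darc K)%type
    (fun e => match e with inl a => inl (src a) | inr b => inr (src b) end)
    (fun e => match e with inl a => inl (tgt a) | inr b => inr (tgt b) end).

Definition splice (H K : digraph)
    (b : {x | x \in exits H} -> {y | y \in entries K})
    (b' : {y | y \in exits K} -> {x | x \in entries H}) : digraph :=
  @identify (disjoint_union H K) (fun p q =>
    match p, q with
    | inl x, inr y => [exists v, (x == val v) && (y == val (b v))]
    | inr y, inl x => [exists w, (y == val w) && (x == val (b' w))]
    | _, _ => false
    end).

Definition obtained_by_collapsing (G : digraph) (F : {set {set darc G}})
    (G' : digraph) : Prop :=
  exists2 r, open_route r & G' = @collapse G F r.

Definition obtained_by_replacing (G : digraph) (F : {set {set darc G}})
    (F' G' : digraph) : Prop :=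
  [/\ is_2digraph F', #|exits F'| = #|exits (subdigraph F)|
    & exists (b : {x | x \in exits (complement F)} -> {y | y \in entries F'})
             (b' : {y | y \in exits F'} -> {x | x \in entries (complement F)}),
        [/\ bijective b, bijective b' & G' = splice b b']].

(* Main.v *)
(* A factor of a 2-dd is a permutation of its vertices.  If all alternating
   cycles have six arcs, two factors differ by 3-cycles, so the parity of the
   number of cycles is the same for all factors.

   Let H be the complement of F.  A factor Y of H contributes to the number of
   cycles of a factor of G its own cycles and the bijection y from entries to
   exits of H that is given by its paths: all other cycles of the factor
   correspond to the orbits of a permutation, determined by y, of the input
   ports of the three hexagons (alternating cycles with six arcs) of F.  Suppose
   that a pair F' of hexagons can be closed up to a single cycle for exactly the
   same bijections y as F, and that there is such a y.  Then replacing F by F'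
   preserves Hamiltonicity, because a Hamiltonian cycle leaves no cycle to Y; and
   it preserves oddness, because the parity of the number of cycles is the sign
   of y plus a constant, which agrees for F and F' at the common y.

   By the hypothesis on pairs, F has at most six saturated vertices, hence three
   or four entries.  Up to the numbering of the ports there are few ways to glue
   three hexagons, and a suitable F' is found for each of them by computation.
   Since a hexagon of F' may be plugged into itself, pairs suffice and neither a
   collapse nor a single hexagon is ever needed. *)

Require Import Defs.
From mathcomp Require Import all_boot.
From mathcomp Require Import fingroup perm zify.

Set Implicit Arguments.
Unset Strict Implicit.
Unset Printing Implicit Defensive.

(** * Cycles of permutations *)

(** Cleanness forbids gluing a hexagon of [F] to itself, so each saturated vertex of [F] belongs to
    one of the three pairs of hexagons, and each pair has at most two of them. Hence five or six of
    the nine output ports are glued inside [F]. The obstacle is that the complement is arbitrary.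
    Therefore [G] and [G'] are both described as an [assembly] of the same context with some plugged
    hexagons. There the number of cycles of a factor splits into the orbits of a permutation [hop]
    of the input ports and the cycles that stay inside the context. The second summand is the same
    on both sides, so two pluggings may be exchanged as soon as their predicates [covers] have the
    same truth table over all routes, and one transfer lemma serves both directions of
    H-equivalence. The search stays small because a hexagon admits all six permutations of its port
    numbers as symmetries, once input port [i] is placed opposite to output port [i]. *)

Lemma fcard_porbits (T : finType) (s : {perm T}) :
  fcard s predT = #|porbits s|.
Proof.
have fcE x y : fconnect s x y = (y \in porbit s x).
  apply/idP/porbitP => [/iter_findex <-|[i ->]].
    by exists (findex s x y); rewrite permX.
  by rewrite permX fconnect_iter.
have sym := fconnect_sym (@perm_inj _ s).
have inj : {in predI (froots s) predT &, injective (porbit s)}.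
  move=> x y /andP[/eqP rx _] /andP[/eqP ry _] /eqP.
  by rewrite eq_porbit_mem -fcE sym => /(rootP sym); rewrite rx ry.
rewrite /n_comp_mem -(card_in_imset inj); apply: eq_card => A.
apply/imsetP/imsetP => [[x _ ->]|[x _ ->]]; first by exists x.
exists (froot s x); first by rewrite inE roots_root.
by apply/eqP; rewrite eq_porbit_mem -fcE sym connect_root.
Qed.

Lemma odd_fcard_perm (T : finType) (s : {perm T}) :
  odd (fcard s predT) = odd #|T| (+) odd_perm s.
Proof. by rewrite fcard_porbits /odd_perm addKb. Qed.

Lemma fcard_eq1P (T : finType) (f : T -> T) (x : T) : injective f ->
  reflect (forall y, fconnect f x y) (fcard f predT == 1).
Proof.
move=> f_inj; have sym := fconnect_sym f_inj.
apply: (iffP idP) => [/eqP f1 y|f1].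
  have /card_le1P c1 : #|predI (froots f) predT| <= 1 by rewrite -f1.
  rewrite -root_connect //; apply/eqP.
  have := c1 (froot f x); rewrite inE roots_root // => /(_ isT (froot f y)).
  by rewrite !inE roots_root //= => /esym/eqP.
have <- : fcard f (fconnect f x) = 1 by apply: n_comp_connect.
by apply/eqP/eq_n_comp_r => y; rewrite !inE f1.
Qed.

(* Such a transport is compatible with products and maps transpositions to
   transpositions. *)
Lemma odd_perm_transport (S T : finType) (h : S -> T) (F : {perm S} -> {perm T}) :
  injective h ->
  (forall s a, F s (h a) = h (s a)) ->
  (forall s x, x \notin codom h -> F s x = x) ->
  forall s, odd_perm (F s) = odd_perm s.
Proof.
move=> h_inj Fh Fo s.
have eF (s1 : {perm S}) (t : {perm T}) : (forall a, t (h a) = h (s1 a)) ->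
    (forall x, x \notin codom h -> t x = x) -> F s1 = t.
  move=> th to; apply/permP => x.
  have [/codomP[a ->]|xh] := boolP (x \in codom h); first by rewrite Fh th.
  by rewrite Fo // to.
have F1 : F 1%g = 1%g by apply: eF => *; rewrite !perm1.
have FM s1 s2 : F (s1 * s2)%g = (F s1 * F s2)%g.
  by apply: eF => [a|x xh]; rewrite !permM ?Fh // !Fo.
have Ft a b : F (tperm a b) = tperm (h a) (h b).
  apply: eF => [c|x xh]; first by rewrite inj_tperm.
  by rewrite tpermD //; apply: contraNneq xh => <-; exact: codom_f.
have [ts -> _] := prod_tpermP s.
elim: ts => [|[a b] ts IH]; first by rewrite !big_nil F1 !odd_perm1.
by rewrite !big_cons FM !odd_permM IH Ft !odd_tperm (inj_eq h_inj).
Qed.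

Lemma odd_perm_cube1 (T : finType) (s : {perm T}) :
  (forall x, s (s (s x)) = x) -> odd_perm s = false.
Proof.
move=> s3; have : (s * s * s)%g = 1%g by apply/permP => x; rewrite !permM perm1.
by move/(congr1 (@odd_perm T)); rewrite !odd_permM odd_perm1; case: odd_perm.
Qed.

(** * Alternating cycles *)

Lemma fiber_partner (E V : finType) (h : E -> V) (e : E) :
  #|[set f | h f == h e]| = 2 ->
  exists f, forall g, (e != g) && (h e == h g) = (g == f).
Proof.
move=> /eqP/cards2P[a [b [ab Eab]]].
have inE' g : (h e == h g) = (g == a) || (g == b).
  by have /setP/(_ g) := Eab; rewrite !inE eq_sym.
have := inE' e; rewrite eqxx => /esym/orP[] /eqP Ee.
  exists b => g; rewrite inE' Ee eq_sym.
  by have [->|] := eqVneq g a; rewrite ?(negPf ab) ?andbT.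
exists a => g; rewrite inE' Ee eq_sym orbC.
by have [->|] := eqVneq g b; rewrite ?[b == a]eq_sym ?(negPf ab) ?andbT.
Qed.

Section Pairing.
Variable D : digraph.

(** The alternating cycles are the orbits of these two involutions, which exchange the arcs with a
    common end and with a common start. Stating each field as an equivalence gives existence and
    uniqueness of the partner at once. *)
Record pairing (tau sig : darc D -> darc D) : Prop := Pairing {
  co_tgtE : forall e f, (e != f) && (tgt e == tgt f) = (f == tau e);
  co_srcE : forall e f, (e != f) && (src e == src f) = (f == sig e) }.

Lemma is_2digraph_indeg e : is_2digraph D -> indeg (tgt (e : darc D)) = 2.
Proof.
have : 0 < indeg (tgt e) by apply/card_gt0P; exists e; rewrite inE.
by move=> p /(_ (tgt e)) /or3P[]; rewrite inE => /andP[/eqP i _];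
  rewrite i in p *.
Qed.

Lemma is_2digraph_outdeg e : is_2digraph D -> outdeg (src (e : darc D)) = 2.
Proof.
have : 0 < outdeg (src e) by apply/card_gt0P; exists e; rewrite inE.
by move=> p /(_ (src e)) /or3P[]; rewrite inE => /andP[_ /eqP i];
  rewrite i in p *.
Qed.

Lemma pairing_exists : is_2digraph D -> exists tau sig, pairing tau sig.
Proof.
move=> D2.
have /fin_all_exists[tau tauP] (e : darc D) :
    exists f, forall g, (e != g) && (tgt e == tgt g) = (g == f).
  by apply/fiber_partner/is_2digraph_indeg.
have /fin_all_exists[sig sigP] (e : darc D) :
    exists f, forall g, (e != g) && (src e == src g) = (g == f).
  by apply/fiber_partner/is_2digraph_outdeg.
by exists tau, sig; split.
Qed.

Variables (tau sig : darc D -> darc D).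
Hypothesis pr : pairing tau sig.

Lemma tauP e : [/\ e != tau e, tgt (tau e) = tgt e & tau (tau e) = e].
Proof.
have := co_tgtE pr e (tau e); rewrite eqxx => /andP[ne /eqP te]; split=> //.
by apply/esym/eqP; rewrite -(co_tgtE pr) eq_sym ne te eqxx.
Qed.

Lemma sigP e : [/\ e != sig e, src (sig e) = src e & sig (sig e) = e].
Proof.
have := co_srcE pr e (sig e); rewrite eqxx => /andP[ne /eqP te]; split=> //.
by apply/esym/eqP; rewrite -(co_srcE pr) eq_sym ne te eqxx.
Qed.

Lemma tauK : involutive tau. Proof. by move=> e; case: (tauP e). Qed.
Lemma sigK : involutive sig. Proof. by move=> e; case: (sigP e). Qed.
Lemma tgt_tau e : tgt (tau e) = tgt e. Proof. by case: (tauP e). Qed.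
Lemma src_sig e : src (sig e) = src e. Proof. by case: (sigP e). Qed.
Lemma tau_neq e : e != tau e. Proof. by case: (tauP e). Qed.
Lemma sig_neq e : e != sig e. Proof. by case: (sigP e). Qed.

Lemma indeg_tgt (e : darc D) : indeg (tgt e) = 2.
Proof.
have -> : indeg (tgt e) = #|[set e; tau e]|.
  apply: eq_card => f; rewrite !inE -(co_tgtE pr) [tgt f == _]eq_sym.
  by rewrite [f == e]eq_sym; case: (eqVneq e f) => //= ->; rewrite eqxx.
by rewrite cards2 tau_neq.
Qed.

Lemma outdeg_src (e : darc D) : outdeg (src e) = 2.
Proof.
have -> : outdeg (src e) = #|[set e; sig e]|.
  apply: eq_card => f; rewrite !inE -(co_srcE pr) [src f == _]eq_sym.
  by rewrite [f == e]eq_sym; case: (eqVneq e f) => //= ->; rewrite eqxx.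
by rewrite cards2 sig_neq.
Qed.

Fixpoint alt e i : darc D :=
  if i is j.+1 then (if odd j then sig else tau) (alt e j) else e.

Definition two_steps e := sig (tau e).
Local Notation st := two_steps.

Lemma alt_double e k : alt e k.*2 = iter k st e.
Proof. by elim: k => //= k <-; rewrite odd_double. Qed.

Lemma alternating_alt n (c : n.-tuple (darc D)) : alternating c ->
  exists e, [/\ c = mkseq (alt e) n :> seq _, alt e n = e, 0 < n & ~~ odd n].
Proof.
case: n c => // n c /and4P[_ odd_n c_uniq /forallP c_alt]; pose e := tnth c ord0.
have nextE (i : 'I_n.+1) :
    tnth c (ordS i) = (if odd i then sig else tau) (tnth c i).
  have ne : tnth c i != tnth c (ordS i).
    have /tuple_uniqP t_inj := c_uniq; rewrite (inj_eq t_inj) -val_eqE /=.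
    have [lt|ge] := ltnP i.+1 n.+1; first by rewrite modn_small //; lia.
    (* The last index is followed by 0; the two differ because a positive even length is at least
       2. *)
    have Ei : i.+1 = n.+1 by have := ltn_ord i; lia.
    rewrite Ei modnn; move: odd_n => /=; lia.
  by have := c_alt i; case: ifP => _ eq_i; apply/eqP;
    rewrite -?(co_srcE pr) -?(co_tgtE pr) ne.
have altE i (lt_i : i < n.+1) : tnth c (Ordinal lt_i) = alt e i.
  elim: i lt_i => [|i IH] lt_i; first by congr tnth; apply: val_inj.
  rewrite /= -(IH (ltnW lt_i)) -(nextE (Ordinal (ltnW lt_i))).
  by congr tnth; apply: val_inj; rewrite /= modn_small.
exists e; split=> //.
- apply: (@eq_from_nth _ e) => [|i]; rewrite size_tuple ?size_mkseq // => lt_i.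
  by rewrite nth_mkseq // -(altE i lt_i) (tnth_nth e).
- have := nextE ord_max; rewrite [tnth c ord_max](altE n (ltnSn n)) /= => <-.
  by congr tnth; apply: val_inj; rewrite /= modnn.
Qed.

Lemma alt_alternating e n : 0 < n -> ~~ odd n -> alt e n = e ->
  uniq (mkseq (alt e) n) -> alternating [tuple alt e i | i < n].
Proof.
move=> n0 odd_n alt_n alt_uniq; rewrite /alternating n0 odd_n /=.
have -> : [tuple alt e i | i < n] = mkseq (alt e) n :> seq _.
  by rewrite /= /mkseq -val_enum_ord -map_comp.
rewrite alt_uniq; apply/forallP => i; rewrite !tnth_mktuple.
have -> : alt e (ordS i) = alt e i.+1.
  have [lt|ge] := ltnP i.+1 n; first by rewrite [val _]modn_small.
  have En : i.+1 = n by have := ltn_ord i; lia.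
  by rewrite [LHS](_ : _ = e) ?En // [val _](_ : _ = 0) //= En modnn.
by rewrite /=; case: (odd i); rewrite ?src_sig ?tgt_tau.
Qed.

Lemma mkseq_AC e n : 0 < n -> ~~ odd n -> alt e n = e ->
  uniq (mkseq (alt e) n) ->
  [set f in mkseq (alt e) n] \in ACs D /\ #|[set f in mkseq (alt e) n]| = n.
Proof.
move=> n0 odd_n alt_n alt_uniq.
have card_n : #|[set f in mkseq (alt e) n]| = n.
  by rewrite cardsE (card_uniqP alt_uniq) size_mkseq.
split=> //; rewrite inE; apply/existsP.
have tE : [tuple alt e i | i < n] = mkseq (alt e) n :> seq _.
  by rewrite /= /mkseq -val_enum_ord -map_comp.
rewrite card_n; exists [tuple alt e i | i < n].
rewrite alt_alternating //=; apply/eqP/setP => f; rewrite !inE.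
by rewrite -tE.
Qed.

Lemma AC_alt A : A \in ACs D -> exists e n,
  [/\ A = [set f in mkseq (alt e) n], uniq (mkseq (alt e) n),
      alt e n = e, 0 < n & ~~ odd n].
Proof.
rewrite inE => /existsP[c /andP[c_alt /eqP EA]].
have [e [Ec en n0 on]] := alternating_alt c_alt; exists e, #|A|; split=> //.
  by rewrite {1}EA; apply/setP => f; rewrite !inE -Ec.
by rewrite -Ec; case/and4P: c_alt.
Qed.

Lemma AC_closed A e : A \in ACs D -> e \in A -> (tau e \in A) /\ (sig e \in A).
Proof.
case/AC_alt => e0 [n [-> u en n0 on]]; rewrite !inE => /mapP[i].
rewrite mem_iota add0n /= => lt_i ->.
have mem j : j <= n -> alt e0 j \in mkseq (alt e0) n.
  rewrite leq_eqVlt => /orP[/eqP ->|lt_j].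
    by rewrite en; apply/mapP; exists 0; rewrite ?mem_iota.
  by apply/mapP; exists j; rewrite ?mem_iota.
(* One of [tau] and [sig] moves forward along the cycle, the other one backward. Going back from
   index 0 leads to the last arc, by [alt e0 n = e0]. *)
have pred : (if odd i then tau else sig) (alt e0 i) \in mkseq (alt e0) n.
  case: i lt_i => [|i] lt_i /=; last first.
    by case: (odd i) => /=; rewrite ?tauK ?sigK mem // ltnW // ltnW.
  case: n n0 on en u lt_i mem => // n _ /= on en _ _ mem.
  by rewrite -{1}en; move: on; case: ifP => // _ _; rewrite sigK mem.
have := mem i.+1 lt_i; rewrite /=.
by case: (odd i) pred.
Qed.

Lemma st_inj : injective st.
Proof. by apply: (can_inj (g := tau \o sig)) => x; rewrite /two_steps /= sigK tauK. Qed.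

(* If [alt e] met itself at indices of different parity, [tau] or [sig] would
   have a fixed arc half way. *)
Lemma alt_order e (m := fingraph.order st e) :
  uniq (mkseq (alt e) m.*2) /\ alt e m.*2 = e.
Proof.
have alt_odd k : alt e k.*2.+1 = tau (iter k st e) by rewrite /= odd_double alt_double.
have stt k x : iter k st (tau (iter k st x)) = tau x.
  elim: k x => // k IH x; rewrite [iter k.+1 st x]iterSr [LHS]/= IH.
  by rewrite /two_steps tauK sigK.
have iter_inj k : injective (iter k st) by elim: k => // k IH x y /st_inj/IH.
have even_odd j k : iter j st e <> tau (iter k st e).
  move=> /(congr1 (iter k st)); rewrite stt -iterD.
  move: (k + j) => {j k} l; rewrite -(odd_double_half l) -addnn addnCA iterD.
  rewrite -(stt l./2) => /iter_inj; case: (odd l) => /= E.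
    by have := sig_neq (tau (iter l./2 st e)); rewrite -[X in X == _]E eqxx.
  by have := tau_neq (iter l./2 st e); rewrite -E eqxx.
have st_lt j k : j < m -> k < m -> iter j st e = iter k st e -> j = k.
  by move=> lj lk E; rewrite -(findex_iter lj) E findex_iter.
have alt_m : alt e m.*2 = e by rewrite alt_double (iter_order st_inj).
split=> //; apply/mkseq_uniqP => i j; rewrite !inE.
rewrite -(odd_double_half i) -(odd_double_half j).
case: (odd i); case: (odd j); rewrite ?add1n ?add0n ?alt_odd ?alt_double => li lj.
- by move=> /(inv_inj tauK)/st_lt-> //; lia.
- by move=> /esym/even_odd.
- by move=> /even_odd.
- by move=> /st_lt-> //; lia.
Qed.

Lemma order_AC e : exists2 A, A \in ACs D & e \in A /\ #|A| = (fingraph.order st e).*2.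
Proof.
have [alt_uniq alt_m] := alt_order e; set m := fingraph.order st e in alt_uniq alt_m *.
have m2 : 0 < m.*2 by rewrite double_gt0 fingraph.order_gt0.
have om : ~~ odd m.*2 by rewrite odd_double.
have [A1 A2] := mkseq_AC m2 om alt_m alt_uniq.
exists [set f in mkseq (alt e) m.*2] => //; split=> //.
by rewrite inE; apply/mapP; exists 0; rewrite ?mem_iota.
Qed.

(* [sig (tau e)] is two steps along the alternating cycle of [e], so all
   alternating cycles have six arcs exactly when this has order 3 everywhere. *)
Definition hexagonal := forall e, st e != e /\ st (st (st e)) = e.

Lemma hexagonal_ACs : all_ACs_size D 6 -> hexagonal.
Proof.
move=> D6 e; have [A AC [eA cA]] := order_AC e.
have o3 : fingraph.order st e = 3 by move: cA; rewrite (D6 A AC); lia.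
split; last by have := iter_order st_inj e; rewrite o3.
apply/negP => /eqP E; have : findex st e (iter 1 st e) = 1 by rewrite findex_iter ?o3.
by rewrite /= E findex0.
Qed.

Hypothesis hx : hexagonal.

Definition hexagon e := mkseq (alt e) 6.

Lemma hexagon_order e : fingraph.order st e = 3.
Proof.
have [n1 e3] := hx e.
have n2 : st (st e) != e.
  by apply/eqP => E; move: e3; rewrite E => E1; rewrite E1 eqxx in n1.
rewrite (@order_cycle _ _ [:: e; st e; st (st e)]) ?inE ?eqxx //=.
  by rewrite !eqxx e3 eqxx.
by rewrite !inE negb_or !(eq_sym e) n1 n2 (inj_eq st_inj) eq_sym n1.
Qed.

Lemma hexagon_uniq e : uniq (hexagon e) /\ alt e 6 = e.
Proof. by have := alt_order e; rewrite hexagon_order. Qed.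

Lemma hexagon_AC e : [set f in hexagon e] \in ACs D.
Proof. by have [u e6] := hexagon_uniq e; case: (mkseq_AC _ _ e6 u). Qed.

Lemma hexagonE e :
  hexagon e = [:: e; tau e; st e; tau (st e); st (st e); tau (st (st e))].
Proof. by []. Qed.

Lemma mem_hexagon e : e \in hexagon e.
Proof. by rewrite inE eqxx. Qed.

(** This is the uniqueness of the partition: an alternating cycle is determined by any of its
    arcs. *)
Lemma AC_hexagon A e : A \in ACs D -> e \in A -> A = [set f in hexagon e].
Proof.
move=> AC eA; have [e0 [n [EA u en n0 on]]] := AC_alt AC.
(* [n./2] steps of [st] return to [e0]. One or two steps contradict order 3, and with more than
   three the arc [e0] would recur at index 6. *)
have n6 : n = 6.
  have n2 : n = n./2.*2 by move: on; lia.
  move: en u; rewrite n2 alt_double => ek u.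
  move: (n./2) ek u n2 => k ek u n2.
  have [e1 e3] := hx e0; have k_gt0 : 0 < k by lia.
  case: k ek u n2 k_gt0 => [|[|[|[|k]]]] // ek u _ _.
  - by move: e1; rewrite -[st e0]/(iter 1 st e0) ek eqxx.
  - by move: e3 e1; rewrite -[st (st (st e0))]/(st (iter 2 st e0)) ek => ->; rewrite eqxx.
  - have /mkseq_uniqP/(_ 6 0) := u; rewrite !inE.
    by case: (hexagon_uniq e0) => _ -> /(_ _ _ erefl) // E; have := E isT isT.
have cA : #|A| = 6 by rewrite EA cardsE (card_uniqP u) size_mkseq.
apply/esym/eqP; rewrite eqEcard cA cardsE (card_uniqP (hexagon_uniq e).1) andbT.
apply/subsetP => f; rewrite inE hexagonE !inE.
have t x : x \in A -> tau x \in A by move=> xA; case: (AC_closed AC xA).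
have s x : x \in A -> sig x \in A by move=> xA; case: (AC_closed AC xA).
have st_A x : x \in A -> st x \in A by move=> xA; apply/s/t.
by do ?[case/predU1P => [->|]]; last move/eqP->; auto.
Qed.

Lemma hexagonal_size6 : all_ACs_size D 6.
Proof.
move=> A AC; have [e0 [n [EA u en n0 on]]] := AC_alt AC.
have e0A : e0 \in A.
  by rewrite EA inE; apply/mapP; exists 0; rewrite ?mem_iota.
by rewrite (AC_hexagon AC e0A) cardsE (card_uniqP (hexagon_uniq e0).1).
Qed.

(** The local form of a factor: one of any two arcs with a common end, and one of any two arcs with
    a common start. *)
Definition balanced (X : {set darc D}) :=
  forall e, ((e \in X) = (tau e \notin X)) /\ ((e \in X) = (sig e \notin X)).

Lemma balanced_alt X e i : balanced X ->
  (alt e i \in X) = odd i (+) (e \in X).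
Proof.
move=> bX; elim: i => //= i IH; case: (odd i) IH => IH.
  by have [_] := bX (alt e i); rewrite IH /= => /(congr1 negb); rewrite !negbK => <-.
by have [+ _] := bX (alt e i); rewrite IH /= => /(congr1 negb); rewrite !negbK => <-.
Qed.

Lemma balanced_factor X : balanced X -> is_factor X.
Proof.
move=> bX n c c_alt; have [e [Ec en n0 on]] := alternating_alt c_alt.
have cE (i : 'I_n) : tnth c i = alt e i by rewrite (tnth_nth e) Ec nth_mkseq.
have [eX|eX] := boolP (e \in X); [left|right]; split.
- by apply/subsetP => _ /imsetP[i +] ->; rewrite inE cE balanced_alt // eX => /negPf->.
- apply/pred0P => f /=; apply/negP => /andP[/imsetP[i +] ->].
  by rewrite inE cE balanced_alt // eX => ->.
- by apply/subsetP => _ /imsetP[i +] ->; rewrite inE cE balanced_alt // (negPf eX) => ->.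
- apply/pred0P => f /=; apply/negP => /andP[/imsetP[i +] ->].
  by rewrite inE cE balanced_alt // (negPf eX) => /negPf->.
Qed.

Lemma factor_balanced X : is_factor X -> balanced X.
Proof.
move=> fX.
have alt01 e i : i.+1 < 6 -> (alt e i \in X) = (alt e i.+1 \notin X).
  move=> i6; have [u e6] := hexagon_uniq e.
  have c_alt := alt_alternating (isT : 0 < 6) isT e6 u.
  have in_f j : j < 6 -> ~~ odd j -> alt e j \in forward [tuple alt e i | i < 6].
    by move=> j6 oj; apply/imsetP; exists (Ordinal j6); rewrite ?inE ?tnth_mktuple.
  have in_b j : j < 6 -> odd j -> alt e j \in backward [tuple alt e i | i < 6].
    by move=> j6 oj; apply/imsetP; exists (Ordinal j6); rewrite ?inE ?tnth_mktuple.
  have [[/subsetP s d]|[/subsetP s d]] := fX _ _ c_alt.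
    have [oi|oi] := boolP (odd i).
      have -> : alt e i.+1 \in X by rewrite s // in_f //= oi.
      by have := disjointFr d (in_b i (ltnW i6) oi) => ->.
    have -> : alt e i \in X by rewrite s // in_f // ltnW.
    by have := disjointFr d (in_b i.+1 i6 oi) => ->.
  have [oi|oi] := boolP (odd i).
    have -> : alt e i \in X by rewrite s // in_b // ltnW.
    by have := disjointFr d (in_f i.+1 i6 _) => -> //=; rewrite oi.
  have -> : alt e i.+1 \in X by rewrite s // in_b.
  by have := disjointFr d (in_f i (ltnW i6) oi) => ->.
move=> e; split; first exact: (alt01 e 0).
(* The cycle started at [tau e] has [e] at index 1 and [sig e] at index 2. *)
by have := alt01 (tau e) 1 isT; rewrite /= tauK.
Qed.

End Pairing.

(** * Factors and their cycles *)

Lemma is_2dd_2digraph D : is_2dd D -> is_2digraph D.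
Proof. by move=> D2 v; rewrite D2 !orbT. Qed.

Section SuccessorMap.
Variable D : digraph.

(** [out v] is the arc of the factor that leaves [v], so [fun v => tgt (out v)] is the permutation
    whose orbits are the cycles of the factor. *)
Record successor (X : {set darc D}) (out : D -> darc D) : Prop := Successor {
  out_in : forall v, out v \in X;
  src_out : forall v, src (out v) = v;
  out_src : forall e, e \in X -> out (src e) = e;
  tgt_out_inj : injective (fun v => tgt (out v)) }.

Hypothesis D2 : is_2dd D.
Variables (tau sig : darc D -> darc D).
Hypothesis pr : pairing tau sig.

Lemma balanced_successor X : balanced tau sig X -> exists out, successor X out.
Proof.
move=> bX.
have /fin_all_exists[out outP] (v : D) : exists e, e \in X /\ src e = v.
  have := D2 v; rewrite inE => /andP[_ /eqP o2].
  have /card_gt0P[e] : 0 < outdeg v by rewrite o2.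
  rewrite inE => /eqP se; have [eX|eX] := boolP (e \in X); first by exists e.
  by exists (sig e); rewrite (src_sig pr) -[_ \in X]negbK -(bX e).2.
have sX e f : e \in X -> f \in X -> src e = src f -> e = f.
  move=> eX fX sef; apply/eqP/negPn/negP => ne.
  have : f == sig e by rewrite -(co_srcE pr) ne sef eqxx.
  by move/eqP => Ef; move: eX; rewrite (bX e).2 -Ef fX.
have tX e f : e \in X -> f \in X -> tgt e = tgt f -> e = f.
  move=> eX fX tef; apply/eqP/negPn/negP => ne.
  have : f == tau e by rewrite -(co_tgtE pr) ne tef eqxx.
  by move/eqP => Ef; move: eX; rewrite (bX e).1 -Ef fX.
exists out; split=> [v|v|e eX|u v /tX E]; try by case: (outP v).
  by case: (outP (src e)) => oX so; apply: sX.
have [uX su] := outP u; have [vX sv] := outP v.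
by rewrite -su -sv E.
Qed.

Lemma dicycle_tuple (c : seq (darc D)) (C : {set darc D}) :
  uniq c -> C = [set e in c] -> dicycle c ->
  [exists c : #|C|.-tuple (darc D), dicycle c && (C == [set e in c])].
Proof.
move=> u EC dc; have sC : size c == #|C| by rewrite EC cardsE (card_uniqP u).
by apply/existsP; exists (Tuple sC); rewrite /= dc {1}EC eqxx.
Qed.

Lemma dicycle_uniq (c : seq (darc D)) : dicycle c -> uniq c.
Proof. by case/and3P => _ _ /map_uniq. Qed.

Section Count.
Variables (X : {set darc D}) (out : D -> darc D).
Hypothesis sX : successor X out.
Let p v := tgt (out v).
Let p_inj : injective p := tgt_out_inj sX.

Lemma orbit_dicycle v : dicycle (map out (fingraph.orbit p v)).
Proof.
have srcK (s : seq D) : map src (map out s) = s.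
  by rewrite -map_comp map_id_in // => u _ /=; rewrite (src_out sX).
rewrite /dicycle srcK orbit_uniq andbT -size_eq0 size_map size_orbit.
rewrite -lt0n fingraph.order_gt0 /=.
have := cycle_orbit p_inj v; rewrite cycle_map; apply: sub_cycle => x y /= /eqP<-.
by rewrite (src_out sX).
Qed.

Lemma dicycle_fcycle c : {subset c <= X} -> dicycle c ->
  fcycle p (map src c) /\ c = map out (map src c).
Proof.
move=> cX /and3P[_ cy _]; split.
  have aX : all (mem X) c by apply/allP.
  rewrite cycle_map; apply: sub_in_cycle aX cy => e f eX fX /= /eqP ef.
  by rewrite /p (out_src sX) // ef.
rewrite -map_comp -[LHS]map_id; apply/eq_in_map => e ec /=.
by rewrite (out_src sX) // cX.
Qed.

(** Each arc of a directed cycle inside [X] is [out] of its start, so the cycle is the orbit of any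
    of its vertices. *)
Lemma card_cycles : #|cycles X| = fcard p predT.
Proof.
pose g v := [set e in map out (fingraph.orbit p v)].
have out_inj : injective out by move=> u v /(congr1 src); rewrite !(src_out sX).
have mem_g u v : (out u \in g v) = fconnect p v u.
  by rewrite inE (mem_map out_inj) fconnect_orbit.
have sym := fconnect_sym p_inj.
rewrite /n_comp_mem -(card_in_imset (f := g)); last first.
  move=> u v /andP[/eqP ru _] /andP[/eqP rv _] /setP/(_ (out v)).
  by rewrite !mem_g connect0 -(root_connect sym) => /eqP; rewrite ru rv.
apply: eq_card => C; rewrite inE; apply/andP/imsetP => [[CX]|[v _ ->]].
  case/existsP=> c /andP[dc /eqP EC].
  have cX : {subset c <= X}.
    by move=> e ec; apply: (subsetP CX); rewrite EC inE.
  have [fc oc] := dicycle_fcycle cX dc.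
  case/and3P: (dc) => c0 _ uc.
  case Es : (map src c) => [|v s].
    by case: (tval c) c0 Es.
  exists (froot p v); first by rewrite inE roots_root.
  rewrite EC; apply/setP => e; rewrite !inE.
  have -> : (e \in c) = (e \in map out (map src c)) by rewrite -oc.
  have [eX|eX] := boolP (e \in X); last first.
    have no s' : (e \in map out s') = false.
      by apply/negP => /mapP[u _ Eu]; rewrite Eu (out_in sX) in eX.
    by rewrite !no.
  rewrite -(out_src sX eX) !(mem_map out_inj) -fconnect_orbit.
  have vs : v \in map src c by rewrite Es mem_head.
  by rewrite -(fconnect_cycle fc vs) -!(root_connect sym) (root_root sym).
split; first by apply/subsetP => e; rewrite inE => /mapP[u _ ->]; apply: out_in sX _.
apply: dicycle_tuple (orbit_dicycle v) => //.
by rewrite (map_inj_uniq out_inj) orbit_uniq.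
Qed.

Lemma fcard1_hamiltonian : fcard p predT = 1 -> hamiltonian D.
Proof.
move=> p1; have /card_gt0P[v _] : 0 < #|predI (froots p) predT|.
  by rewrite -[X in _ < X]/(fcard p predT) p1.
exists (map out (fingraph.orbit p v)); first exact: orbit_dicycle.
move=> u; have /(fcard_eq1P v p_inj)/(_ u) : fcard p predT == 1 by rewrite p1.
rewrite fconnect_orbit => uo; apply/mapP; exists (out u); rewrite ?(src_out sX) //.
exact: map_f.
Qed.

End Count.

Lemma successor_balanced X out : successor X out -> balanced tau sig X.
Proof.
move=> sX e.
pose p v := tgt (out v); have p_inj : injective p := tgt_out_inj sX.
have inX f : (f \in X) = (out (src f) == f).
  by apply/idP/eqP => [/(out_src sX)|<-]; rewrite ?(out_in sX).
split; last first.
  rewrite !inX (src_sig pr); set f := out _.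
  have sf : src e == src f by rewrite (src_out sX).
  have [<-|ne] := eqVneq f e; first by rewrite (sig_neq pr).
  by rewrite -(co_srcE pr) eq_sym ne sf.
(* [finv p] gives the vertex before [tgt e], so [f] is the arc of [X] that enters [tgt e]. *)
pose f := out (finv p (tgt e)).
have tf : tgt f = tgt e by rewrite -[tgt f]/(p _) f_finv.
have inXt g : tgt g = tgt e -> (g \in X) = (f == g).
  move=> tg; apply/idP/eqP => [gX|<-]; last exact: out_in sX _.
  rewrite -(out_src sX gX); congr out; apply: (p_inj).
  by rewrite f_finv // -tg /p (out_src sX gX).
rewrite !inXt ?(tgt_tau pr) //.
have [->|ne] := eqVneq f e; first by rewrite (tau_neq pr).
by rewrite -(co_tgtE pr) eq_sym ne tf eqxx.
Qed.

Lemma hamiltonianP : hamiltonian D -> exists X out,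
  [/\ balanced tau sig X, successor X out & fcard (fun v => tgt (out v)) predT = 1].
Proof.
case=> c dc call; pose X := [set e in c].
have [c0 cy u] := and3P dc.
have cX : {subset c <= X} by move=> e; rewrite inE.
have sX : {in X &, injective src}.
  move=> e f; rewrite !inE => ec fc sef.
  rewrite -(nth_index e ec) -(nth_index e fc); congr (nth e c _).
  apply/eqP; rewrite -(nth_uniq (src e) _ _ u) ?size_map ?index_mem //.
  by rewrite !(nth_map e) ?index_mem // !nth_index // sef.
have /fin_all_exists[out outP] (v : D) : exists e, e \in X /\ src e = v.
  by have /mapP[e ec ->] := call v; exists e; rewrite inE.
have sXo : successor X out.
  split=> [v|v|e eX|v w E]; try by case: (outP v).
    by case: (outP (src e)) => oX so; apply: sX.
  (* The end of an arc of the cycle is the start of the next one. Arcs of the cycle are determined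
     by their starts, so equal ends give equal next arcs. *)
  have [[vX sv] [wX sw]] := (outP v, outP w); rewrite !inE in vX wX.
  have nx : src (next c (out v)) = src (next c (out w)).
    have /eqP <- := next_cycle cy vX; have /eqP <- := next_cycle cy wX.
    exact: E.
  have := sX _ _ _ _ nx; rewrite !inE !mem_next => /(_ vX wX)/(congr1 (prev c)).
  by rewrite !prev_next ?(dicycle_uniq dc) // => Eo; rewrite -sv -sw Eo.
exists X, out; split=> //; first exact: successor_balanced sXo.
have [fc _] := dicycle_fcycle sXo cX dc.
case: c c0 {cy u sX outP} @X call cX sXo dc fc => // e c _ X call cX sXo dc fc.
apply/eqP/(fcard_eq1P (src e) (tgt_out_inj sXo)) => v.
by rewrite (fconnect_cycle fc) ?mem_head.
Qed.

End SuccessorMap.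

(** * Hexagons plugged into a context *)

Definition port n := ('I_n * 'I_3)%type.
(** Input port [i] of a hexagon has arcs to the two output ports with other numbers, and [rot3 b]
    selects one of them. The same [b] at all three input ports yields one of the two factors of the
    hexagon. *)
Definition rot3 (b : bool) (i : 'I_3) : 'I_3 := if b then ord_pred i else ordS i.
Definition turn n (b : bool) (p : port n) : port n := (p.1, rot3 b p.2).

Lemma rot3_inj b : injective (rot3 b).
Proof. by case: b; [exact: can_inj (@ord_predK 3)|exact: can_inj (@ordSK 3)]. Qed.

(** This is [tau] on a hexagon: two turns one way equal one turn the other way, so the arc
    [(rot3 (~~ b) i, ~~ b)] has the same end as [(i, b)]. *)
Lemma rot3_partner b b' i j :
  ((i, b) != (j, b')) && (rot3 b i == rot3 b' j) = ((j, b') == (rot3 (~~ b) i, ~~ b)).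
Proof.
by case: b b' i j => [] [] [[|[|[|//]]] ?] [[|[|[|//]]] ?].
Qed.

Lemma rot3_neq b i : rot3 b i != i.
Proof. by case: b i => [] [[|[|[|//]]] ?]. Qed.

Lemma rot3K b : cancel (rot3 b) (rot3 (~~ b)).
Proof. by case: b; [exact: ord_predK|exact: ordSK]. Qed.

Lemma rot3_3 b i : rot3 b (rot3 b (rot3 b i)) = i.
Proof. by apply: val_inj; case: b i => [] [[|[|[|//]]] ?]. Qed.

Lemma turnK n b : cancel (@turn n b) (turn (~~ b)).
Proof. by case=> k i; rewrite /turn /= rot3K. Qed.

Section Model.
Variables (n N : nat) (w : port n -> port n + 'I_N) (el : 'I_N -> port n).

(* [n] hexagons are plugged together and into a context: the output port [o]
   is glued to the input port [p] if [w o = inl p] and to the [a]-th entry of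
   the context if [w o = inr a]; its [a]-th exit is glued to the input port
   [el a]. *)
Record plugging : Prop := Plugging {
  w_inj : injective w;
  el_inj : injective el;
  w_el : forall o a, w o <> inl (el a);
  w_or_el : forall p, (exists a, p = el a) \/ exists o, w o = inl p;
  w_ext : forall a, exists o, w o = inr a }.

Definition link (y : 'I_N -> 'I_N) (o : port n) : port n :=
  match w o with inl p => p | inr a => el (y a) end.

(** From an input port to the next one: through the hexagon along the factor given by [c], then
    across the gluing or along the path of the context given by [y]. *)
Definition hop (y : 'I_N -> 'I_N) (c : 'I_n -> bool) (q : port n) : port n :=
  link y (turn (c q.1) q).

Hypothesis pl : plugging.

Lemma link_inj y : injective y -> injective (link y).
Proof.
move=> y_inj o o'; rewrite /link.
case Eo : (w o) => [p|a]; case Eo' : (w o') => [p'|a'] => E.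
- by apply: (w_inj pl); rewrite Eo Eo' E.
- by case: (w_el pl (o := o) (a := y a')); rewrite Eo E.
- by case: (w_el pl (o := o') (a := y a)); rewrite Eo' E.
- by apply: (w_inj pl); rewrite Eo Eo' (y_inj _ _ (el_inj pl E)).
Qed.

Lemma turn_inj (c : 'I_n -> bool) : injective (fun q : port n => turn (c q.1) q).
Proof. by move=> [k i] [k' i'] [/= <-] /rot3_inj ->. Qed.

Lemma hop_inj y c : injective y -> injective (hop y c).
Proof. by move=> y_inj q q' /(link_inj y_inj)/turn_inj. Qed.

(* Choosing another factor of a hexagon composes with a 3-cycle, so only the
   sign of the route [y] matters. *)
Lemma odd_hop : exists kappa, forall (y : 'S_N) c,
  odd (fcard (hop y c) predT) = kappa (+) odd_perm y.
Proof.
(* [hop y c] is the product of the turns, of the link for the identity route, and of [y] transported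
   along [el]. Only the last factor depends on [y], and the first is even. *)
pose L := perm (link_inj (@inj_id 'I_N)).
have lifted (y : 'S_N) : exists2 t : {perm port n},
    forall a, t (el a) = el (y a) & forall p, p \notin codom el -> t p = p.
  pose f p := if [pick a | el a == p] is Some a then el (y a) else p.
  have fel a : f (el a) = el (y a).
    rewrite /f; case: pickP => [b /eqP/(el_inj pl)->//|/(_ a)].
    by rewrite eqxx.
  have fo p : p \notin codom el -> f p = p.
    rewrite /f; case: pickP => // a /eqP <-; by rewrite codom_f.
  have f_inj : injective f.
    move=> p q; have [/codomP[a ->]|pn] := boolP (p \in codom el);
    have [/codomP[b ->]|qn] := boolP (q \in codom el); rewrite ?fel ?fo //.
    - by move=> /(el_inj pl)/perm_inj->.
    - by move=> Eq; rewrite -Eq codom_f in qn.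
    - by move=> Ep; rewrite Ep codom_f in pn.
  by exists (perm f_inj) => [a|p pn]; rewrite permE ?fel ?fo.
have /fin_all_exists2[F Fel Fo] : forall y : 'S_N, exists2 t : {perm port n},
    forall a, t (el a) = el (y a) & forall p, p \notin codom el -> t p = p := lifted.
exists (odd #|{: port n}| (+) odd_perm L) => y c.
pose C := perm (@turn_inj c).
have -> : fcard (hop y c) predT = fcard (C * L * F y)%g predT.
  apply: eq_fcard => q; rewrite !permM !permE /hop /link.
  case Ew : (w _) => [p|a]; rewrite ?Fel // Fo //.
  by apply/codomP => -[a Ea]; case: (w_el pl (a := a) (etrans Ew (congr1 inl Ea))).
rewrite odd_fcard_perm !odd_permM (odd_perm_transport (el_inj pl) Fel Fo).
have -> : odd_perm C = false.
  apply: odd_perm_cube1 => -[k i]; rewrite !permE /turn /=.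
  by rewrite rot3_3.
by rewrite addbA.
Qed.

End Model.

(** * Routes and trapped cycles of the context *)

Section Context.
Variables (N : nat) (H : digraph) (alpha beta : 'I_N -> H).

(* [alpha] and [beta] enumerate the entry and the exit vertices of [H]. *)
Record boundary : Prop := Boundary {
  alpha_inj : injective alpha;
  beta_inj : injective beta;
  alpha_beta : forall a b, alpha a <> beta b;
  alpha_tgt : forall a e, tgt e <> alpha a;
  beta_src : forall a e, src e <> beta a;
  alpha_or : forall x, (exists a, x = alpha a) \/ exists e, x = tgt e;
  beta_or : forall x, (exists a, x = beta a) \/ exists e, x = src e }.

Hypothesis bd : boundary.
Variables (tau sig : darc H -> darc H).
Hypothesis pr : pairing tau sig.
Variable Y : {set darc H}.
Hypothesis bY : balanced tau sig Y.

Lemma step_fun x u v : step Y x u -> step Y x v -> u = v.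
Proof.
case/exists_inP => e eY /andP[/eqP se /eqP te].
case/exists_inP => f fY /andP[/eqP sf /eqP tf].
suff Eef : e = f by rewrite -te -tf Eef.
apply/eqP/negPn/negP => ne; have : f == sig e.
  by rewrite -(co_srcE pr) ne se sf eqxx.
by move/eqP => Ef; move: eY; rewrite (bY e).2 -Ef fY.
Qed.

Lemma step_inj x u v : step Y u x -> step Y v x -> u = v.
Proof.
case/exists_inP => e eY /andP[/eqP se /eqP te].
case/exists_inP => f fY /andP[/eqP sf /eqP tf].
suff Eef : e = f by rewrite -se -sf Eef.
apply/eqP/negPn/negP => ne; have : f == tau e.
  by rewrite -(co_tgtE pr) ne te tf eqxx.
by move/eqP => Ef; move: eY; rewrite (bY e).1 -Ef fY.
Qed.

Lemma step_out x : (exists a, x = beta a) \/ exists2 e, e \in Y & x = src e.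
Proof.
case: (beta_or bd x) => [|[e ->]]; [by left|right].
have [eY|eY] := boolP (e \in Y); first by exists e.
by exists (sig e); rewrite ?(src_sig pr) // -[_ \in _]negbK -(bY e).2.
Qed.

Lemma step_arc e : e \in Y -> step Y (src e) (tgt e).
Proof. by move=> eY; apply/exists_inP; exists e; rewrite ?eqxx. Qed.

Lemma step_beta a x : ~~ step Y (beta a) x.
Proof. by apply/exists_inP => -[e _ /andP[/eqP/(beta_src bd)]]. Qed.

Lemma step_alpha a x : ~~ step Y x (alpha a).
Proof. by apply/exists_inP => -[e _ /andP[_ /eqP/(alpha_tgt bd)]]. Qed.

Lemma connect_terminal (T : finType) (e : rel T) x t t' :
  (forall x u v, e x u -> e x v -> u = v) ->
  (forall v, ~~ e t v) -> (forall v, ~~ e t' v) ->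
  connect e x t -> connect e x t' -> t = t'.
Proof.
move=> e_fun tt tt' /connectP[p ep Ep] /connectP[q eq Eq].
move: tt tt' ep eq; rewrite {}Ep {}Eq.
elim: p q x => [|u p IH] [|v q] x //=.
- by move=> /(_ v) + _ _ /andP[xv _]; rewrite xv.
- by move=> _ /(_ u) + /andP[xu _]; rewrite xu.
move=> tp tq /andP[xu up] /andP[xv vq]; have Ev := e_fun _ _ _ xv xu.
by rewrite Ev in tq vq *; apply: IH.
Qed.

Definition route_of (y : 'I_N -> 'I_N) :=
  forall a, connect (step Y) (alpha a) (beta (y a)).

Lemma route_inj y : route_of y -> injective y.
Proof.
move=> yP a a' Ey; apply: (alpha_inj bd).
(* The paths are followed backwards: the reversed step relation is functional, and the entries are
   its terminal vertices. *)
have rv b : connect [rel u v | step Y v u] (beta (y b)) (alpha b).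
  by rewrite connect_rev /=; apply: yP.
apply: (@connect_terminal _ [rel u v | step Y v u] (beta (y a))) (rv a) _.
- by move=> x u v; apply: step_inj.
- by move=> v; apply: step_alpha.
- by move=> v; apply: step_alpha.
by rewrite Ey.
Qed.

(* A vertex is trapped if it lies on a cycle of [Y], so that [num_trapped]
   counts the cycles of [Y]; it does not depend on the digraph [H] is part of. *)
Definition trapped := [pred x | [forall a, ~~ connect (step Y) x (beta a)]].
Definition link_sym := [rel u v | step Y u v || step Y v u].
Definition num_trapped := n_comp link_sym trapped.

Lemma trapped_step x u : step Y x u -> trapped x = trapped u.
Proof.
move=> xu; apply: eq_forallb => a; congr negb; apply/idP/idP; last first.
  by apply: connect_trans; apply: connect1.
case/connectP=> -[|v p] /=; first by move=> _ E; move: xu; rewrite -E (negPf (step_beta a u)).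
by case/andP => /(step_fun xu) <- up ->; apply/connectP; exists p.
Qed.

End Context.

(** * Factors of an assembly and the number of their cycles *)

Section Assembly.
Variables (n N : nat) (H : digraph) (alpha beta : 'I_N -> H).
Variables (w : port n -> port n + 'I_N) (el : 'I_N -> port n).
Variable D : digraph.
Variables (ih : H -> D) (ip : port n -> D).
Variables (ah : darc H -> darc D) (ak : port n * bool -> darc D).

Definition exit_of (o : port n) : D :=
  match w o with inl p => ip p | inr a => ih (alpha a) end.

Definition arc_of (z : darc H + port n * bool) : darc D :=
  match z with inl e => ah e | inr x => ak x end.

(* [D] is obtained from [H] and [n] hexagons by the gluing described by [w] and
   [el]: [ih] and [ip] send the vertices of [H] and the input ports to the
   vertices of [D]; output ports need no map, as each of them is glued to an
   input port or to an entry of [H]. *)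
Record assembly : Prop := Assembly {
  arc_of_bij : bijective arc_of;
  src_ah : forall e, src (ah e) = ih (src e);
  tgt_ah : forall e, tgt (ah e) = ih (tgt e);
  src_ak : forall x, src (ak x) = ip x.1;
  tgt_ak : forall x, tgt (ak x) = exit_of (turn x.2 x.1);
  ih_inj : injective ih;
  ip_inj : injective ip;
  ih_ip : forall x p, ih x = ip p -> exists a, x = beta a;
  ih_beta : forall a, ih (beta a) = ip (el a);
  ih_or_ip : forall v, (exists x, v = ih x) \/ exists p, v = ip p }.

Hypothesis bd : boundary alpha beta.
Variables (tauH sigH : darc H -> darc H).
Hypothesis prH : pairing tauH sigH.
Hypothesis pl : plugging w el.
Hypothesis cl : assembly.

Lemma ah_inj : injective ah.
Proof.
by move=> e f E; have /(_ (inl e) (inl f) E)[] := bij_inj (arc_of_bij cl).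
Qed.

Lemma ak_inj : injective ak.
Proof.
by move=> x x' E; have /(_ (inr x) (inr x') E)[] := bij_inj (arc_of_bij cl).
Qed.

Lemma exit_of_inj : injective exit_of.
Proof.
move=> o o'; rewrite /exit_of.
case E : (w o) => [p|a]; case E' : (w o') => [p'|a'].
- by move/(ip_inj cl) => Ep; apply: (w_inj pl); rewrite E E' Ep.
- by move/esym/(ih_ip cl) => [b /(alpha_beta bd)].
- by move/(ih_ip cl) => [b /(alpha_beta bd)].
- by move/(ih_inj cl)/(alpha_inj bd) => Ea; apply: (w_inj pl); rewrite E E' Ea.
Qed.

Lemma ih_exit x o : ih x = exit_of o -> exists a, x = alpha a.
Proof.
rewrite /exit_of; case E : (w o) => [p|a].
  move=> Ex; have [a Ea] := ih_ip cl Ex; move: Ex.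
  rewrite Ea (ih_beta cl) => /(ip_inj cl) Ep.
  by case: (w_el pl (o := o) (a := a)); rewrite E Ep.
by move/(ih_inj cl) => ->; exists a.
Qed.

(** The two pairings merely combine: at a vertex where the context meets a hexagon, both in-arcs
    come from one side and both out-arcs from the other. *)
Lemma assembly_pairing : exists tau sig, [/\ pairing tau sig,
  forall e, tau (ah e) = ah (tauH e), forall e, sig (ah e) = ah (sigH e),
  forall p b, tau (ak (p, b)) = ak (turn (~~ b) p, ~~ b) &
  forall p b, sig (ak (p, b)) = ak (p, ~~ b)].
Proof.
have [code codeK arcK] := arc_of_bij cl.
pose tauZ z := match z with inl e => inl (tauH e)
  | inr x => inr (turn (~~ x.2) x.1, ~~ x.2) end : darc H + port n * bool.
pose sigZ z := match z with inl e => inl (sigH e)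
  | inr x => inr (x.1, ~~ x.2) end : darc H + port n * bool.
exists (fun e => arc_of (tauZ (code e))), (fun e => arc_of (sigZ (code e))).
split; first last.
- by move=> p b; rewrite -[ak _]/(arc_of (inr (p, b))) codeK.
- by move=> p b; rewrite -[ak _]/(arc_of (inr (p, b))) codeK.
- by move=> e; rewrite -[ah _]/(arc_of (inl e)) codeK.
- by move=> e; rewrite -[ah _]/(arc_of (inl e)) codeK.
have arc_inj := can_inj codeK.
split=> e f; rewrite -(arcK e) -(arcK f) codeK !(inj_eq arc_inj);
  case: (code e) => [e'|[p b]]; case: (code f) => [f'|[p' b']] /=.
- rewrite !(tgt_ah cl) (inj_eq (ih_inj cl)).
  by rewrite !(inj_eq inl_inj) -(co_tgtE prH).
- rewrite (tgt_ah cl) (tgt_ak cl); apply/negbTE/negP => /eqP/ih_exit[a].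
  by move/(alpha_tgt bd).
- rewrite (tgt_ah cl) (tgt_ak cl); apply/negbTE/negP => /eqP/esym/ih_exit[a].
  by move/(alpha_tgt bd).
- rewrite !(tgt_ak cl) (inj_eq exit_of_inj) !(inj_eq inr_inj).
  case: p p' => [k i] [k' i']; rewrite /turn !xpair_eqE /=.
  have := rot3_partner b b' i i'; rewrite !xpair_eqE.
  by rewrite [k' == k]eq_sym; case: (k == k'); rewrite /= ?andbF.
- rewrite !(src_ah cl) (inj_eq (ih_inj cl)).
  by rewrite !(inj_eq inl_inj) -(co_srcE prH).
- rewrite (src_ah cl) (src_ak cl); apply/negbTE/negP => /eqP/(ih_ip cl)[a].
  by move/(beta_src bd).
- rewrite (src_ah cl) (src_ak cl); apply/negbTE/negP => /eqP/esym/(ih_ip cl)[a].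
  by move/(beta_src bd).
- rewrite !(src_ak cl) (inj_eq (ip_inj cl)) !(inj_eq inr_inj) !xpair_eqE /=.
  by rewrite [p' == p]eq_sym; case: (p == p'); case: b b' => [] [].
Qed.

Lemma assembly_2dd : is_2dd D.
Proof.
have [tau [sig [pr _ _ _ _]]] := assembly_pairing.
have inp p : exists e, ip p = tgt (e : darc D).
  have [[a ->]|[o Eo]] := w_or_el pl p.
    rewrite -(ih_beta cl); have [[b /esym/(alpha_beta bd)]|[e ->]] // := alpha_or bd (beta a).
    by exists (ah e); rewrite (tgt_ah cl).
  (* [turn false] undoes [turn true], so this arc ends at the output port [o]. *)
  exists (ak (turn true o, false)); rewrite (tgt_ak cl).
  by rewrite -[false]/(~~ true) turnK /exit_of Eo.
have inh x : exists e, ih x = tgt (e : darc D).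
  have [[a ->]|[e ->]] := alpha_or bd x; last by exists (ah e); rewrite (tgt_ah cl).
  have [o Eo] := w_ext pl a.
  exists (ak (turn true o, false)); rewrite (tgt_ak cl).
  by rewrite -[false]/(~~ true) turnK /exit_of Eo.
have outp p : exists e, ip p = src (e : darc D).
  by exists (ak (p, true)); rewrite (src_ak cl).
have outh x : exists e, ih x = src (e : darc D).
  have [[a ->]|[e ->]] := beta_or bd x; last by exists (ah e); rewrite (src_ah cl).
  by rewrite (ih_beta cl).
move=> v; rewrite inE.
have [e Ee] : exists e, v = tgt (e : darc D).
  by have [[x ->]|[p ->]] := ih_or_ip cl v.
have [f Ef] : exists e, v = src (e : darc D).
  by have [[x ->]|[p ->]] := ih_or_ip cl v.
by rewrite {1}Ee (indeg_tgt pr) Ef (outdeg_src pr) eqxx.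
Qed.

Definition factor_of (Y : {set darc H}) (c : 'I_n -> bool) : {set darc D} :=
  [set arc_of z | z in [pred z | match z with inl e => e \in Y
    | inr x => x.2 == c x.1.1 end]].

Lemma factor_of_ah Y c e : (ah e \in factor_of Y c) = (e \in Y).
Proof.
rewrite -[ah e]/(arc_of (inl e)) mem_imset //; exact: (bij_inj (arc_of_bij cl)).
Qed.

Lemma factor_of_ak Y c x : (ak x \in factor_of Y c) = (x.2 == c x.1.1).
Proof.
rewrite -[ak x]/(arc_of (inr x)) mem_imset //; exact: (bij_inj (arc_of_bij cl)).
Qed.

Lemma arc_cases e : (exists e', e = ah e') \/ exists p b, e = ak (p, b).
Proof.
have [code _ arcK] := arc_of_bij cl; rewrite -(arcK e).
by case: (code e) => [e'|[p b]]; [left; exists e'|right; exists p, b].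
Qed.

Variables tau sig : darc D -> darc D.
Hypothesis pr : pairing tau sig.

(** A pairing is unique, so an arbitrary one on [D] agrees with the one that is built from the
    parts. *)
Lemma tau_ah e : tau (ah e) = ah (tauH e).
Proof.
have [tau' [sig' [pr' <- _ _ _]]] := assembly_pairing.
by apply/esym/eqP; rewrite -(co_tgtE pr) (co_tgtE pr').
Qed.

Lemma sig_ah e : sig (ah e) = ah (sigH e).
Proof.
have [tau' [sig' [pr' _ <- _ _]]] := assembly_pairing.
by apply/esym/eqP; rewrite -(co_srcE pr) (co_srcE pr').
Qed.

Lemma tau_ak p b : tau (ak (p, b)) = ak (turn (~~ b) p, ~~ b).
Proof.
have [tau' [sig' [pr' _ _ <- _]]] := assembly_pairing.
by apply/esym/eqP; rewrite -(co_tgtE pr) (co_tgtE pr').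
Qed.

Lemma sig_ak p b : sig (ak (p, b)) = ak (p, ~~ b).
Proof.
have [tau' [sig' [pr' _ _ _ <-]]] := assembly_pairing.
by apply/esym/eqP; rewrite -(co_srcE pr) (co_srcE pr').
Qed.

Lemma assembly_hexagonal : hexagonal tauH sigH -> hexagonal tau sig.
Proof.
move=> hH e; rewrite /two_steps; have [[e' ->]|[[k i] [b ->]]] := arc_cases e.
  rewrite !(tau_ah, sig_ah) (inj_eq ah_inj).
  by have [ne e3] := hH e'; split=> //; congr ah.
rewrite !(tau_ak, sig_ak) /= !negbK /turn /= !(inj_eq ak_inj) !xpair_eqE eqxx /=.
by rewrite eqxx andbT rot3_neq rot3_3.
Qed.

Lemma assembly_hexagonal_context : hexagonal tau sig -> hexagonal tauH sigH.
Proof.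
move=> hD e; have [] := hD (ah e); rewrite /two_steps !(tau_ah, sig_ah) (inj_eq ah_inj).
by move=> ne /ah_inj.
Qed.

Lemma factor_of_balanced Y c : balanced tauH sigH Y -> balanced tau sig (factor_of Y c).
Proof.
move=> bY e; have [[e' ->]|[[k i] [b ->]]] := arc_cases e.
  by rewrite tau_ah sig_ah !factor_of_ah.
rewrite tau_ak sig_ak !factor_of_ak /=.
by case: b (c k) => [] [].
Qed.

Lemma balanced_factor_of X : balanced tau sig X ->
  exists Y c, balanced tauH sigH Y /\ X = factor_of Y c.
Proof.
move=> bX; pose Y := [set e | ah e \in X].
pose c k := ak ((k, ord0), true) \in X; exists Y, c; split.
  by move=> e; rewrite !inE -tau_ah -sig_ah; apply: bX.
have rotX k i b b' : (ak ((k, i), b) \in X) = (b == b') (+) ~~ (ak ((k, i), b') \in X).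
  case: (eqVneq b b') => [->|]; first by rewrite addTb negbK.
  have -> : (b != b') = (b' == ~~ b) by case: b b' => [] [].
  by move/eqP ->; rewrite -sig_ak addFb; case: (bX (ak (k, i, b))).
(* [tau] followed by [sig] passes to the next input port with the same flag. Each of them switches
   membership in [X], so a flag is chosen at all three input ports of a hexagon or at none. *)
have rotI k i : (ak ((k, rot3 false i), true) \in X) = (ak ((k, i), true) \in X).
  have := (bX (ak ((k, i), true))).1; rewrite tau_ak /turn /= => ->.
  by rewrite (rotX _ _ false true) addFb negbK.
have cP k i : (ak ((k, i), true) \in X) = c k.
  have [->|[->|->]] : i = ord0 \/ i = rot3 false ord0 \/ i = rot3 false (rot3 false ord0).
  - by case: i => [[|[|[|//]]] ?]; [left|right; left|right; right]; apply: val_inj.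
  - by [].
  - by rewrite rotI.
  - by rewrite !rotI.
apply/setP => e; have [[e' ->]|[[k i] [b ->]]] := arc_cases e.
  by rewrite factor_of_ah inE.
by rewrite factor_of_ak /= (rotX k i b true) cP; case: b (c k) => [] [].
Qed.

Section Count.
Variables (Y : {set darc H}) (c : 'I_n -> bool).
Hypothesis bY : balanced tauH sigH Y.
Variable out : D -> darc D.
Hypothesis sX : successor (factor_of Y c) out.
Let p v := tgt (out v).
Let p_inj : injective p := tgt_out_inj sX.

Lemma p_ih e : e \in Y -> p (ih (src e)) = ih (tgt e).
Proof.
by move=> eY; rewrite -(src_ah cl) /p (out_src sX) ?factor_of_ah // (tgt_ah cl).
Qed.

Lemma p_ip q : p (ip q) = exit_of (turn (c q.1) q).
Proof.
have -> : ip q = src (ak (q, c q.1)) by rewrite (src_ak cl).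
by rewrite /p (out_src sX) ?factor_of_ak /= ?eqxx // (tgt_ak cl).
Qed.

Lemma p_step x x' : step Y x x' -> p (ih x) = ih x'.
Proof. by case/exists_inP => e eY /andP[/eqP <- /eqP <-]; apply: p_ih. Qed.

Lemma step_connect x x' : connect (step Y) x x' -> fconnect p (ih x) (ih x').
Proof.
case/connectP => s + ->; elim: s x => [|x1 s IH] x /=; first by rewrite connect0.
case/andP => /p_step Ex /IH; apply: connect_trans.
by rewrite -Ex fconnect1.
Qed.

Lemma reach_exit m x q : iter m p (ih x) = ip q -> exists a, connect (step Y) x (beta a).
Proof.
elim: m x => [|m IH] x; first by case/(ih_ip cl) => a ->; exists a.
have [[a ->] _|[e eY ->]] := step_out bd prH bY x; first by exists a.
rewrite iterSr p_ih // => /IH[a ea]; exists a.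
by apply: connect_trans ea; apply/connect1/step_arc.
Qed.

Lemma route_exists : exists y, route_of alpha beta Y y.
Proof.
suff /fin_all_exists[y yP] a : exists b, connect (step Y) (alpha a) (beta b).
  by exists y.
(* The entry [alpha a] is glued to [o], and [q] is the input port from which the chosen factor leads
   to [o]. As [p] is a permutation, the orbit of [alpha a] comes back to [q], so it leaves the
   context. *)
have [o Eo] := w_ext pl a; set q : port n := turn (~~ c o.1) o.
have pq : p (ip q) = ih (alpha a).
  by rewrite p_ip /= -{1}[c _]negbK turnK /exit_of Eo.
have : iter (fingraph.order p (ih (alpha a))).-1 p (ih (alpha a)) = ip q.
  rewrite -[LHS]/(finv p _); apply: p_inj.
  by rewrite (f_finv p_inj) pq.
by move/reach_exit.
Qed.

Variable y : 'I_N -> 'I_N.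
Hypothesis yP : route_of alpha beta Y y.

Lemma ip_hop q : fconnect p (ip q) (ip (hop w el y c q)).
Proof.
apply: connect_trans (fconnect1 _ _) _; rewrite p_ip /hop /link /exit_of.
case: (w _) => [q'|a]; first by rewrite connect0.
by rewrite -(ih_beta cl); apply/step_connect/yP.
Qed.

(** The bound [m' <= m] feeds the strong induction in [ip_connect], where one step has already been
    spent inside a hexagon. *)
Lemma reach_port m x b q : connect (step Y) x (beta b) ->
  iter m p (ih x) = ip q ->
  exists2 m', m' <= m & iter m' p (ip (el b)) = ip q.
Proof.
have end_beta x' a : connect (step Y) x' (beta b) -> x' = beta a -> ih x' = ip (el b).
  move=> + Ex'; rewrite Ex' => ab; rewrite -(ih_beta cl); congr ih.
  apply: (connect_terminal (step_fun prH bY) _ _ (connect0 _ _) ab);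
    by move=> v; apply: (step_beta bd).
elim: m x => [|m IH] x xb E.
  have [a /(end_beta _ _ xb) Ex] := ih_ip cl E.
  by exists 0 => //=; rewrite -E -Ex.
have [[a /(end_beta _ _ xb) Ex]|[e eY Ex]] := step_out bd prH bY x.
  by exists m.+1 => //; rewrite -Ex.
move: E; rewrite Ex iterSr p_ih // => /IH [|m' m'm <-]; last by exists m' => //; apply: leqW.
move: xb; rewrite Ex => /connectP[[|v s] /=].
  by move=> _ /esym/(beta_src bd).
case/andP => /(step_fun prH bY (step_arc eY)) <- vs Eb.
by apply/connectP; exists s.
Qed.

(** [hop] is the return map of [p] to the input ports, because a walk that enters the context can
    only leave it along the route. *)
Lemma ip_connect q q' :
  fconnect p (ip q) (ip q') = fconnect (hop w el y c) q q'.
Proof.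
apply/idP/idP => [/iter_findex|].
  move: (findex _ _ _) => m; elim/ltn_ind: m q => m IH q.
  case: m IH => [_ /(ip_inj cl)->|m IH]; first by rewrite connect0.
  rewrite iterSr p_ip /exit_of => E.
  apply: connect_trans (fconnect1 _ _) _; move: E; rewrite /hop /link.
  case: (w _) => [q1|a]; first exact: IH.
  by case/(reach_port (yP a)) => m' m'm /IH; apply.
case/connectP => s + ->; elim: s q => [|q1 s IH] q /=; first by rewrite connect0.
by case/andP => /eqP <- /IH; apply: connect_trans; apply: ip_hop.
Qed.

Lemma count_cycles :
  fcard p predT = fcard (hop w el y c) predT + num_trapped beta Y.
Proof.
have y_inj := route_inj bd prH bY yP.
have p_sym := fconnect_sym p_inj.
have hop_sym := fconnect_sym (hop_inj (c := c) pl y_inj).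
(* [A] is the union of the orbits that meet an input port; what remains lies inside the context and
   is trapped. *)
pose A := [pred v | [exists q, fconnect p v (ip q)]].
have clA : fclosed p A.
  move=> v u /eqP <-; rewrite !inE; apply: eq_existsb => q.
  exact: same_fconnect1.
rewrite (n_compC A); congr (_ + _).
  rewrite (adjunction_n_comp ip p_sym hop_sym clA); last first.
    split=> [v|q q' _]; last by rewrite ip_connect.
    rewrite inE => Av; have /sigW[q vq] : exists q, fconnect p v (ip q).
      exact/existsP.
    by exists q.
  apply: eq_n_comp_r => q; rewrite !inE; apply/existsP; exists q.
  exact: connect0.
have trapE x : (ih x \in [predC A]) = trapped beta Y x.
  rewrite !inE negb_exists; apply/forallP/forallP => h a.
    apply/negP => /step_connect xa; have := h (el a).
    by rewrite -(ih_beta cl) xa.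
  apply/negP => /iter_findex/reach_exit[b xb].
  by have := h b; rewrite xb.
have ls_sym : connect_sym (link_sym Y).
  by apply: sym_connect_sym => x u; rewrite /= orbC.
(* [step Y] is not a function on the whole context, since it is undefined at the exits. The orbits
   of [p] are therefore recast as components of a symmetric relation, to be compared with
   [link_sym]. *)
pose fs := [rel u v | (p u == v) || (p v == u)].
have fs_sym : connect_sym fs.
  by apply: sym_connect_sym => x u; rewrite /= orbC.
have fsE : fconnect p =2 connect fs.
  move=> u v; apply/idP/idP; apply: connect_sub => {u v} u v /=.
    by move/eqP => <-; apply: connect1; rewrite /= eqxx.
  case/orP => /eqP <-; first exact: fconnect1.
  by rewrite p_sym; apply: fconnect1.
rewrite (eq_n_comp fsE).
have clA' : closed fs [predC A].
  apply: predC_closed => u v /= /orP[] /eqP <-; last apply/esym;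
    exact: (fclosed1 clA).
have ih_codom v : v \in [predC A] -> exists x, v = ih x.
  have [[x ->]|[q ->]] := ih_or_ip cl v; first by exists x.
  by rewrite !inE negb_exists => /forallP/(_ q); rewrite connect0.
rewrite (adjunction_n_comp ih fs_sym ls_sym clA').
  by apply: eq_n_comp_r => x; rewrite inE trapE.
apply: strict_adjunction => //; first exact: ih_inj cl.
  by apply/subsetP => v /ih_codom[x ->]; apply: codom_f.
have stepE x x' : trapped beta Y x -> (p (ih x) == ih x') = step Y x x'.
  move=> tx; have [[a Ex]|[e eY Ex]] := step_out bd prH bY x.
    by move/forallP/(_ a): tx; rewrite Ex connect0.
  rewrite {1}Ex p_ih // (inj_eq (ih_inj cl)); apply/eqP/idP => [<-|xx'].
    by rewrite Ex step_arc.
  by apply: (step_fun prH bY _ xx'); rewrite Ex step_arc.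
move=> x x'; rewrite negbK /= => Ax; rewrite stepE -?trapE //; congr (_ || _).
have [tx'|tx'] := boolP (trapped beta Y x'); first exact: stepE.
move: Ax tx'; rewrite trapE => tx ntx'; apply/idP/idP; last first.
  by move/(trapped_step bd prH bY); rewrite tx (negPf ntx').
move/eqP => Ep; have : ih x' \in [predC A].
  by rewrite (clA' (ih x') (ih x)) ?trapE //= Ep eqxx.
by rewrite trapE (negPf ntx').
Qed.

End Count.

End Assembly.

(* If the paths of a factor of the context induce [y], then [covers w el y] says
   that some factor of the hexagons joins these paths into a single cycle. *)
Definition covers n N (w : port n -> port n + 'I_N) el (y : 'S_N) : bool :=
  [exists c : {ffun 'I_n -> bool}, fcard (hop w el y c) predT == 1].

Lemma coversP n N (w : port n -> port n + 'I_N) el (y : 'S_N) c :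
  fcard (hop w el y c) predT = 1 -> covers w el y.
Proof.
move=> f1; apply/existsP; exists (finfun c); apply/eqP.
rewrite -[RHS]f1; apply: eq_fcard => q.
by rewrite /hop ffunE.
Qed.

Section FactorCount.
Variables (n N : nat) (H : digraph) (alpha beta : 'I_N -> H).
Variables (w : port n -> port n + 'I_N) (el : 'I_N -> port n).
Variable D : digraph.
Variables (ih : H -> D) (ip : port n -> D).
Variables (ah : darc H -> darc D) (ak : port n * bool -> darc D).
Hypothesis bd : boundary alpha beta.
Variables (tauH sigH : darc H -> darc H).
Hypothesis prH : pairing tauH sigH.
Hypothesis pl : plugging w el.
Hypothesis cl : assembly alpha beta w el ih ip ah ak.
Variables tau sig : darc D -> darc D.
Hypothesis pr : pairing tau sig.

Lemma factor_successor Y c : balanced tauH sigH Y ->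
  exists out : D -> darc D, successor (factor_of ah ak Y c) out.
Proof.
move=> bY; apply: (balanced_successor (assembly_2dd bd prH pl cl) pr).
exact: (factor_of_balanced bd prH pl cl pr).
Qed.

Lemma factor_count Y c (y : 'S_N) out :
  balanced tauH sigH Y -> successor (factor_of ah ak Y c) out ->
  route_of alpha beta Y y ->
  fcard (fun v => tgt (out v)) predT
    = fcard (hop w el y c) predT + num_trapped beta Y.
Proof. by move=> bY sX yP; apply: (count_cycles bd prH pl cl bY sX yP). Qed.

Lemma factor_route Y : balanced tauH sigH Y -> exists y : 'S_N, route_of alpha beta Y y.
Proof.
move=> bY; have [out sX] := factor_successor (fun=> true) bY.
have [y yP] := route_exists bd prH pl cl bY sX.
exists (perm (route_inj bd prH bY yP)) => a; rewrite permE; exact: yP.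
Qed.

End FactorCount.

(** * Exchanging one plugging for another in the same context *)

Section Transfer.
Variables (n n' N : nat) (H : digraph) (alpha beta : 'I_N -> H).
Variables (w : port n -> port n + 'I_N) (el : 'I_N -> port n).
Variables (w' : port n' -> port n' + 'I_N) (el' : 'I_N -> port n').
Variables D D' : digraph.
Variables (ih : H -> D) (ip : port n -> D).
Variables (ah : darc H -> darc D) (ak : port n * bool -> darc D).
Variables (ih' : H -> D') (ip' : port n' -> D').
Variables (ah' : darc H -> darc D') (ak' : port n' * bool -> darc D').
Hypothesis bd : boundary alpha beta.
Variables (tauH sigH : darc H -> darc H).
Hypotheses (prH : pairing tauH sigH) (hxH : hexagonal tauH sigH).
Hypotheses (pl : plugging w el) (pl' : plugging w' el').
Hypothesis cl : assembly alpha beta w el ih ip ah ak.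
Hypothesis cl' : assembly alpha beta w' el' ih' ip' ah' ak'.

Lemma transfer_hamiltonian :
  0 < n -> (forall y, covers w el y -> covers w' el' y) ->
  hamiltonian D -> hamiltonian D'.
Proof.
move=> n0 cov; have D2 := assembly_2dd bd prH pl cl.
have [tau [sig pr]] := pairing_exists (is_2dd_2digraph D2).
have [tau' [sig' pr']] :=
  pairing_exists (is_2dd_2digraph (assembly_2dd bd prH pl' cl')).
case/(hamiltonianP pr) => X [out [bX sX c1]].
have [Y [c [bY EX]]] := balanced_factor_of bd prH pl cl pr bX.
rewrite EX in sX; have [y yP] := factor_route bd prH pl cl pr bY.
have := factor_count bd prH pl cl bY sX yP; rewrite c1 => c1'.
(* There is at least one port, hence at least one orbit of [hop], so a total of 1 forces
   [num_trapped] to be 0. *)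
have hop0 : 0 < fcard (hop w el y c) predT.
  have hop_inj := hop_inj (c := c) pl (@perm_inj _ y).
  apply/(fcard_gt0P hop_inj) => //.
  by exists (Ordinal n0, ord0).
have /cov/existsP[c' /eqP hop1] : covers w el y by apply: (@coversP _ _ _ _ _ c); lia.
have [out' sX'] := factor_successor bd prH pl' cl' pr' c' bY.
apply: (fcard1_hamiltonian sX').
by rewrite (factor_count bd prH pl' cl' bY sX' yP) hop1; lia.
Qed.

Lemma transfer_odd : (exists y, covers w el y && covers w' el' y) ->
  odd_2dd D -> odd_2dd D'.
Proof.
move=> [y0 /andP[/existsP[c0 /eqP f0] /existsP[c0' /eqP f0']]] [D2 oD].
have D2' := assembly_2dd bd prH pl' cl'; split=> // X' fX'.
have [tau [sig pr]] := pairing_exists (is_2dd_2digraph D2).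
have [tau' [sig' pr']] := pairing_exists (is_2dd_2digraph D2').
have hx' := assembly_hexagonal bd prH pl' cl' pr' hxH.
have bX' := factor_balanced pr' hx' fX'.
have [Y [c' [bY EX']]] := balanced_factor_of bd prH pl' cl' pr' bX'.
have [out' sX'] := balanced_successor D2' pr' bX'.
have [y yP] := factor_route bd prH pl cl pr bY.
(* Any choice for the hexagons of [D] serves here, as the parity depends on [Y] alone; [c0] is at
   hand. *)
have [out sX] := factor_successor bd prH pl cl pr c0 bY.
have := oD _ (balanced_factor pr (factor_of_balanced bd prH pl cl pr c0 bY)).
rewrite (card_cycles sX) (card_cycles sX').
rewrite (factor_count bd prH pl cl bY sX yP).
rewrite EX' in sX'; rewrite (factor_count bd prH pl' cl' bY sX' yP) !oddD.
have [k kP] := odd_hop pl; have [k' kP'] := odd_hop pl'.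
have := kP y0 c0; have := kP' y0 c0'; rewrite f0 f0' /= kP kP'.
by case: k {kP} k' {kP'} (odd_perm y0) => [] [] [].
Qed.

End Transfer.

(** * Splicing *)

Lemma match_bij N (T T' : finType) (A : {set T}) (A' : {set T'})
    (f : 'I_N -> T) (f' : 'I_N -> T') :
  injective f -> injective f' ->
  (forall x, x \in A <-> exists a, x = f a) ->
  (forall x, x \in A' <-> exists a, x = f' a) ->
  exists2 b : {x | x \in A} -> {x | x \in A'}, bijective b
    & forall u a, val u = f a -> val (b u) = f' a.
Proof.
move=> f_inj f'_inj Af Af'.
have /fin_all_exists[g gP] (u : {x | x \in A}) : exists a, val u = f a.
  by apply/Af/(valP u).
have /fin_all_exists[g' gP'] (u : {x | x \in A'}) : exists a, val u = f' a.
  by apply/Af'/(valP u).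
have fA a : f a \in A by apply/Af; exists a.
have fA' a : f' a \in A' by apply/Af'; exists a.
exists (fun u => Sub (f' (g u)) (fA' (g u))).
  exists (fun u => Sub (f (g' u)) (fA (g' u))) => u; apply: val_inj => /=.
    by rewrite [RHS]gP; congr f; apply: f'_inj; rewrite -gP'.
  by rewrite [RHS]gP'; congr f'; apply: f_inj; rewrite -gP.
by move=> u a Eu /=; congr f'; apply: f_inj; rewrite -gP.
Qed.

(** The gluing relation of a splice is a matching, so the equivalence that it generates adds nothing
    but reflexivity. *)
Lemma connect_matching (T : finType) (e : rel T) x y :
  symmetric e -> (forall x u v, e x u -> e x v -> u = v) ->
  connect e x y -> x = y \/ e x y.
Proof.
move=> e_sym e_fun /connectP[p + ->{y}].
elim: p x => [|u p IH] x /=; first by left.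
case/andP => xu /IH[<-|uy]; first by right.
by left; apply: e_fun uy; rewrite e_sym.
Qed.

Section Boundary.
Variables (N : nat) (H : digraph) (alpha beta : 'I_N -> H).
Hypothesis bd : boundary alpha beta.
Variables (tau sig : darc H -> darc H).
Hypothesis pr : pairing tau sig.

Lemma indeg_eq0 x : (forall e : darc H, tgt e <> x) -> indeg x = 0.
Proof.
move=> no; apply/eqP; rewrite cards_eq0; apply/eqP/setP => e.
by rewrite !inE; apply/negP => /eqP/no.
Qed.

Lemma outdeg_eq0 x : (forall e : darc H, src e <> x) -> outdeg x = 0.
Proof.
move=> no; apply/eqP; rewrite cards_eq0; apply/eqP/setP => e.
by rewrite !inE; apply/negP => /eqP/no.
Qed.

Lemma exits_beta x : x \in exits H <-> exists a, x = beta a.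
Proof.
rewrite inE; split=> [/andP[_ /eqP o0]|[a ->]].
  by have [//|[e Ex]] := beta_or bd x; move: o0; rewrite Ex (outdeg_src pr).
rewrite (outdeg_eq0 (@beta_src _ _ _ _ bd a)) andbT.
have [[b /esym/(alpha_beta bd)//]|[e ->]] := alpha_or bd (beta a).
by rewrite (indeg_tgt pr).
Qed.

Lemma entries_alpha x : x \in entries H <-> exists a, x = alpha a.
Proof.
rewrite inE; split=> [/andP[/eqP o0 _]|[a ->]].
  by have [//|[e Ex]] := alpha_or bd x; move: o0; rewrite Ex (indeg_tgt pr).
rewrite (indeg_eq0 (@alpha_tgt _ _ _ _ bd a)) /=.
have [[b /(alpha_beta bd)//]|[e ->]] := beta_or bd (alpha a).
by rewrite (outdeg_src pr).
Qed.

End Boundary.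

(** * The 2-digraph formed by plugged hexagons *)

Section HexDigraph.
Variables (n N : nat) (w : port n -> port n + 'I_N) (el : 'I_N -> port n).

(** The vertices are the input ports and the [N] exits. An output port has no vertex of its own: its
    arcs end wherever [w] glues it. *)
Definition hex_digraph : digraph :=
  @Digraph (port n + 'I_N)%type (port n * bool)%type
    (fun x => inl x.1) (fun x => w (turn x.2 x.1)).

Hypothesis pl : plugging w el.

Definition hex_tau (x : darc hex_digraph) : darc hex_digraph :=
  (turn (~~ x.2) x.1, ~~ x.2).
Definition hex_sig (x : darc hex_digraph) : darc hex_digraph := (x.1, ~~ x.2).

Lemma hex_pairing : pairing hex_tau hex_sig.
Proof.
split=> -[[k i] b] [[k' i'] b'] /=.
  rewrite (inj_eq (w_inj pl)) /hex_tau /turn !xpair_eqE /=.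
  have := rot3_partner b b' i i'; rewrite !xpair_eqE.
  by rewrite [k' == k]eq_sym; case: (k == k'); rewrite /= ?andbF.
rewrite (inj_eq inl_inj) /hex_sig !xpair_eqE /=.
by rewrite [k' == k]eq_sym [i' == i]eq_sym; case: (k == k'); case: (i == i');
  case: b b' => [] [].
Qed.

Lemma hex_hexagonal : hexagonal hex_tau hex_sig.
Proof.
move=> [[k i] b]; rewrite /two_steps /hex_tau /hex_sig /turn /= !xpair_eqE.
by rewrite !negbK eqxx /= (negPf (rot3_neq _ _)) rot3_3.
Qed.

Lemma hex_el_tgt a e : tgt (e : darc hex_digraph) <> inl (el a).
Proof. exact: (@w_el _ _ _ _ pl). Qed.

Lemma hex_inr_src a e : src (e : darc hex_digraph) <> inr a.
Proof. by []. Qed.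

Lemma hex_tgt (v : hex_digraph) :
  (exists a, v = inl (el a)) \/ exists e, v = tgt (e : darc hex_digraph).
Proof.
have tE o : exists e, w o = tgt (e : darc hex_digraph).
  by exists (turn true o, false); rewrite /= -[false]/(~~ true) turnK.
case: v => [p|a].
  have [[a ->]|[o <-]] := w_or_el pl p; first by left; exists a.
  by right; apply: tE.
by have [o <-] := w_ext pl a; right; apply: tE.
Qed.

Lemma hex_src p : inl p = src ((p, true) : darc hex_digraph).
Proof. by []. Qed.

Lemma hex_entries v : v \in entries hex_digraph <-> exists a, v = inl (el a).
Proof.
rewrite inE; split=> [/andP[/eqP i0 _]|[a ->]].
  by have [//|[e Ev]] := hex_tgt v; move: i0; rewrite Ev (indeg_tgt hex_pairing).
by rewrite (indeg_eq0 (hex_el_tgt (a := a))) hex_src (outdeg_src hex_pairing).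
Qed.

Lemma hex_exits v : v \in exits hex_digraph <-> exists a, v = inr a.
Proof.
rewrite inE; case: v => [p|a].
  rewrite [in outdeg _]hex_src (outdeg_src hex_pairing) andbF; by split=> // -[].
split=> [_|_]; first by exists a.
rewrite (outdeg_eq0 (hex_inr_src (a := a))) andbT.
have [[b //]|[e ->]] := hex_tgt (inr a); by rewrite (indeg_tgt hex_pairing).
Qed.

Lemma hex_2digraph : is_2digraph hex_digraph.
Proof.
move=> v; case: v => [p|a]; last first.
  by apply/or3P/Or32/hex_exits; exists a.
have [Ev|[e Ev]] := hex_tgt (inl p); first by apply/or3P/Or31/hex_entries.
apply/or3P/Or33; rewrite inE {1}Ev (indeg_tgt hex_pairing) /=.
by rewrite hex_src (outdeg_src hex_pairing).
Qed.

Lemma hex_size6 : all_ACs_size hex_digraph 6.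
Proof. exact: (hexagonal_size6 hex_pairing hex_hexagonal). Qed.

Lemma hex_card_ACs : #|ACs hex_digraph| = n.
Proof.
pose B k : {set darc hex_digraph} := [set x : port n * bool | x.1.1 == k].
have cB k : #|B k| = 6.
  pose f (z : 'I_3 * bool) : darc hex_digraph := ((k, z.1), z.2).
  have f_inj : injective f by move=> [i b] [i' b'] [-> ->].
  have <- : #|f @: setT| = 6.
    by rewrite (card_imset _ f_inj) cardsT card_prod card_ord card_bool.
  apply: eq_card => -[[k' i] b]; rewrite inE /=.
  apply/eqP/imsetP => [->|[[i' b'] _ [-> _ _]] //].
  by exists (i, b).
have hexB (e : darc hex_digraph) : [set f in hexagon hex_tau hex_sig e] = B e.1.1.
  apply/eqP; rewrite eqEcard cB cardsE.
  rewrite (card_uniqP (hexagon_uniq hex_pairing hex_hexagonal e).1) andbT.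
  apply/subsetP => f; rewrite inE hexagonE !inE.
  by do ?[case/predU1P => [->|]]; last move/eqP->.
have B_inj : injective B.
  move=> k k' /setP/(_ ((k, ord0), true)); rewrite !inE eqxx => /esym/eqP //.
rewrite -[RHS]card_ord -cardsT -(card_imset _ B_inj); apply: eq_card => A.
apply/idP/imsetP => [AC|[k _ ->]].
  have /card_gt0P[e eA] : 0 < #|A| by rewrite (hex_size6 AC).
  exists e.1.1 => //; rewrite -hexB.
  exact: (AC_hexagon hex_pairing hex_hexagonal AC eA).
have <- := hexB ((k, ord0), true).
exact: (hexagon_AC hex_pairing hex_hexagonal).
Qed.

End HexDigraph.

Section Splice.
Variables (n N : nat) (w : port n -> port n + 'I_N) (el : 'I_N -> port n).
Variables (H : digraph) (alpha beta : 'I_N -> H).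
Hypothesis pl : plugging w el.
Hypothesis bd : boundary alpha beta.
Variables (tau sig : darc H -> darc H).
Hypothesis pr : pairing tau sig.
Local Notation M := (hex_digraph w).

Lemma splice_assembly :
  exists (b : {x | x \in exits H} -> {y | y \in entries M})
         (b' : {y | y \in exits M} -> {x | x \in entries H}),
    [/\ bijective b, bijective b' & exists ih ip ah ak,
        @assembly n N H alpha beta w el (splice b b') ih ip ah ak].
Proof.
have inlel_inj : injective (fun a => inl (el a) : M).
  by move=> a a' [/(el_inj pl)].
have [b b_bij bP] := match_bij (beta_inj bd) inlel_inj (exits_beta bd pr) (hex_entries pl).
have [b' b'_bij bP'] := match_bij (@inr_inj (port n) 'I_N) (alpha_inj bd)
  (hex_exits pl) (entries_alpha bd pr).
exists b, b'; split=> //.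
pose U := disjoint_union H M.
pose gl : rel U := fun p q => match p, q with
    | inl x, inr y => [exists v, (x == val v) && (y == val (b v))]
    | inr y, inl x => [exists v, (y == val v) && (x == val (b' v))]
    | _, _ => false end.
have glb x y : gl (inl x) (inr y) -> exists2 a, x = beta a & y = inl (el a).
  case/existsP => v /andP[/eqP -> /eqP ->].
  have /(exits_beta bd pr)[a Ea] := valP v.
  by exists a => //; apply: bP.
have glb' x y : gl (inr y) (inl x) -> exists2 a, x = alpha a & y = inr a.
  case/existsP => v /andP[/eqP -> /eqP ->].
  have /(hex_exits pl)[a Ea] := valP v.
  by exists a => //; apply: bP'.
have bgl a : gl (inl (beta a)) (inr (inl (el a))).
  have xa : beta a \in exits H by apply/(exits_beta bd pr); exists a.
  apply/existsP; exists (Sub (beta a) xa); rewrite SubK eqxx eq_sym.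
  by apply/eqP; apply: bP; rewrite SubK.
have bgl' a : gl (inr (inr a)) (inl (alpha a)).
  have xa : (inr a : M) \in exits M by apply/(hex_exits pl); exists a.
  apply/existsP; exists (Sub (inr a) xa); rewrite SubK eqxx eq_sym.
  by apply/eqP; apply: bP'; rewrite SubK.
have g_sym : symmetric (glue_sym gl) by move=> u v; rewrite /glue_sym orbC.
(* Each vertex has at most one partner: [beta a] is matched with the free input port [el a], and the
   exit [a] of the hexagons with [alpha a]. Disjointness of entries and exits of the context
   excludes a second partner. *)
have g_fun x u v : glue_sym gl x u -> glue_sym gl x v -> u = v.
  case: x u v => [x|y] [u|u] [v|v] // /orP[] // g1 /orP[] // g2.
  - have [a Ex ->] := glb _ _ g1; have [a' Ex' ->] := glb _ _ g2.
    by have /(beta_inj bd) -> : beta a = beta a' by rewrite -Ex.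
  - have [a Ex ->] := glb _ _ g1; have [a' Ex' ->] := glb' _ _ g2.
    by case: (alpha_beta bd (a := a') (b := a)); rewrite -Ex.
  - have [a Ex ->] := glb' _ _ g1; have [a' Ex' ->] := glb _ _ g2.
    by case: (alpha_beta bd (a := a) (b := a')); rewrite -Ex'.
  - have [a Ex ->] := glb' _ _ g1; have [a' Ex' ->] := glb' _ _ g2.
    by have /(alpha_inj bd) -> : alpha a = alpha a' by rewrite -Ex.
  - have [a -> Ex] := glb' _ _ g1; have [a' -> Ex'] := glb' _ _ g2.
    by move: Ex'; rewrite Ex => -[->].
  - have [a -> Ex] := glb' _ _ g1; have [a' -> Ex'] := glb _ _ g2.
    by move: Ex'; rewrite Ex.
  - have [a -> Ex] := glb _ _ g1; have [a' -> Ex'] := glb' _ _ g2.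
    by move: Ex'; rewrite Ex.
  - have [a -> Ex] := glb _ _ g1; have [a' -> Ex'] := glb _ _ g2.
    by move: Ex'; rewrite Ex => -[/(el_inj pl) ->].
have gcE x y : glue_class gl x = glue_class gl y -> x = y \/ glue_sym gl x y.
  move/(congr1 val) => /= /(rootP (glue_sym_connect gl)).
  exact: connect_matching.
have gc_glue x y : gl x y -> glue_class gl x = glue_class gl y.
  move=> xy; apply: val_inj => /=; apply/(rootP (glue_sym_connect gl)).
  by apply: connect1; rewrite /glue_sym xy.
have gc_surj v : exists z, v = glue_class gl z.
  by exists (val v); apply: val_inj => /=; apply/esym/eqP; exact: valP v.
exists (fun x => glue_class gl (inl x)), (fun p => glue_class gl (inr (inl p))).
exists inl, inr; split=> //.
- by exists id; case.
- move=> x; rewrite /exit_of; case: x => p r /=.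
  by case: (w _) => [//|a]; apply: gc_glue.
- by move=> x x' /gcE[[]|].
- by move=> x x' /gcE[[]|].
- move=> x p /gcE[//|/orP[/glb[a -> _]|/glb'[a _ //]]]; by exists a.
- by move=> a; apply: gc_glue.
move=> v; have [[x|[p|a]] ->] := gc_surj v.
- by left; exists x.
- by right; exists p.
- by left; exists (alpha a); apply: gc_glue.
Qed.

End Splice.

(** * Computing with lists of ports *)

Definition code n (p : port n) : nat := 3 * p.1 + p.2.
Definition decode n (v : nat) : port n.+1 := (inord (v %/ 3), inord (v %% 3)).

Lemma code_lt n (p : port n) : code p < 3 * n.
Proof. by rewrite /code; have := ltn_ord p.1; have := ltn_ord p.2; lia. Qed.

Lemma code_inj n : injective (@code n).
Proof.
move=> p q E; rewrite (surjective_pairing p) (surjective_pairing q).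
have := ltn_ord p.2; have := ltn_ord q.2; move: E; rewrite /code => E lq lp.
by congr (_, _); apply: val_inj => /=; lia.
Qed.

Lemma decodeK n v : v < 3 * n.+1 -> code (decode n v) = v.
Proof. by move=> lt_v; rewrite /code !inordK //=; lia. Qed.

Lemma codeK n : cancel (@code n.+1) (decode n).
Proof. by move=> p; apply: code_inj; rewrite decodeK // code_lt. Qed.

Section ListModel.
Variables (n N : nat).
Let m := 3 * n.+1.

(** Entry [code o] of [lw] is the code of an input port if it is below [m]; the value [m + a] stands
    for the [a]-th entry of the context. *)
Definition w_of (lw : seq nat) (o : port n.+1) : port n.+1 + 'I_N.+1 :=
  let v := nth 0 lw (code o) in if v < m then inl (decode n v) else inr (inord (v - m)).

Definition el_of (le : seq nat) (a : 'I_N.+1) : port n.+1 := decode n (nth 0 le a).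

End ListModel.

Definition plug_ok m N (lw le : seq nat) :=
  [&& size lw == m, size le == N, uniq (lw ++ le), all (fun v => v < m) le
    & all (fun v => v < m + N) lw].

Definition glue_list m (lw le ly : seq nat) :=
  [seq if v < m then v else nth 0 le (nth 0 ly (v - m)) | v <- lw].

(* If [nth 0 l] permutes the numbers below [size l], then [seq_full l] says that
   it is a single cycle. *)
Definition seq_full (l : seq nat) :=
  (fix go k p :=
     if k is k'.+1 then (if p is 0 then false else go k' (nth 0 l p)) else p == 0)
  (size l).-1 (nth 0 l 0).

Fixpoint bool_seqs n : seq (seq bool) :=
  if n is n'.+1 then
    [seq false :: s | s <- bool_seqs n'] ++ [seq true :: s | s <- bool_seqs n']
  else [:: [::]].

Definition turn_list n (c : seq bool) : seq nat :=
  flatten [seq if nth false c k then [:: 3 * k + 2; 3 * k; 3 * k + 1]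
               else [:: 3 * k + 1; 3 * k + 2; 3 * k] | k <- iota 0 n].

Definition turn_lists n := [seq turn_list n c | c <- bool_seqs n].

(** [covers] in list form: [W] lists [link], each [t] lists the turns for one choice of factors, and
    their composite lists [hop]. *)
Definition covb (tl : seq (seq nat)) m (lw le ly : seq nat) : bool :=
  let W := glue_list m lw le ly in
  has (fun t => seq_full [seq nth 0 W o | o <- t]) tl.

Definition perm_seq N (y : 'S_N) : seq nat := [seq val (y a) | a <- enum 'I_N].

Lemma nth_perm_seq N (y : 'S_N) (a : 'I_N) : nth 0 (perm_seq y) a = y a.
Proof. by rewrite (nth_map a) ?size_enum_ord // nth_ord_enum. Qed.

Lemma mem_bool_seqs n s : (s \in bool_seqs n) = (size s == n).
Proof.
elim: n s => [|n IH] [|b s] //=; rewrite mem_cat.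
  by apply/negbTE/norP; split; apply/mapP => -[].
rewrite eqSS -IH; apply/orP/idP => [[] /mapP[s' + [_ ->]] //|sn].
by case: b; [right|left]; apply: map_f.
Qed.

Lemma nth_turn_list n (c : seq bool) (q : port n) :
  nth 0 (turn_list n c) (code q) = code (turn (nth false c q.1) q).
Proof.
pose row k := if nth false c k then [:: 3 * k + 2; 3 * k; 3 * k + 1]
  else [:: 3 * k + 1; 3 * k + 2; 3 * k].
have row3 k : size (row k) = 3 by rewrite /row; case: ifP.
have nth_rows l k i : i < 3 -> k < size l ->
    nth 0 (flatten [seq row j | j <- l]) (3 * k + i) = nth 0 (row (nth 0 l k)) i.
  move=> i3; elim: l k => [|j l IH] [|k] //= kl; rewrite nth_cat row3 ?muln0 ?i3 //.
  by rewrite ifF -?IH //; [congr nth; lia|lia].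
rewrite /turn_list -/row {1}/code nth_rows ?size_iota ?nth_iota //.
rewrite add0n /row /code /turn /=.
by case: q => k [[|[|[|//]]] ?] /=; case: (nth false c k); rewrite /= ?addn0.
Qed.

Lemma size_turn_list n c : size (turn_list n c) = 3 * n.
Proof.
rewrite /turn_list size_flatten /shape -map_comp.
rewrite (@eq_map _ _ _ (fun=> 3)) => [|k]; last by rewrite /=; case: ifP.
have E s : sumn [seq 3 | _ <- s : seq nat] = 3 * size s.
  by elim: s => //= _ s ->; rewrite mulnS.
by rewrite E size_iota.
Qed.

(** The iteration starts at [h x] and is compared with [x] at every step, which is how [seq_full]
    proceeds. *)
Lemma first_return (T : finType) (h : T -> T) x m : injective h ->
  (fingraph.order h x == m.+1) =
  (iter m h (h x) == x) && [forall j : 'I_m, iter j h (h x) != x].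
Proof.
move=> h_inj; have itr := iter_order h_inj x.
have o0 := fingraph.order_gt0 h x.
have small j : 0 < j < fingraph.order h x -> iter j h x != x.
  case/andP => j0 jo; apply/eqP => E.
  by have := findex_iter jo; rewrite E findex0; lia.
apply/eqP/andP => [o|[/eqP Em /forallP min]].
  rewrite -iterSr -o itr eqxx; split=> //; apply/forallP => j.
  by rewrite -iterSr small // o /= ltnS.
have := leq_eqVlt (fingraph.order h x) m.+1.
case: (ltngtP (fingraph.order h x) m.+1) => // lt _.
  have jm : (fingraph.order h x).-1 < m by lia.
  have := min (Ordinal jm); rewrite -iterSr.
  have -> : (Ordinal jm : nat).+1 = fingraph.order h x by rewrite /= prednK.
  by rewrite itr eqxx.
by have := small m.+1; rewrite iterSr Em eqxx lt => /(_ isT).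
Qed.

Lemma seq_fullE n (h : port n.+1 -> port n.+1) l : injective h ->
  size l = 3 * n.+1 -> (forall q, nth 0 l (code q) = code (h q)) ->
  seq_full l = (fcard h predT == 1).
Proof.
move=> h_inj sl lh; pose q0 : port n.+1 := (ord0, ord0).
have c0 q : (code q == 0) = (q == q0).
  by rewrite -(inj_eq (@code_inj _)).
have -> : (fcard h predT == 1) = (fingraph.order h q0 == (3 * n.+1).-1.+1).
  have -> : (3 * n.+1).-1.+1 = #|{: port n.+1}| by rewrite card_prod !card_ord; lia.
  apply/(fcard_eq1P q0 h_inj)/eqP => [all_q|o q].
    by apply: eq_card => q; rewrite [LHS]all_q.
  have /setP/(_ q) : [set q | fconnect h q0 q] = setT.
    have cq : #|[set q | fconnect h q0 q]| = #|{: port n.+1}|.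
      by rewrite -[RHS]o; apply: eq_card => r; rewrite inE.
    by apply/eqP; rewrite eqEcard subsetT cardsT cq /=.
  by rewrite !inE.
have l0 : nth 0 l 0 = code (h q0) by rewrite -lh.
rewrite first_return // /seq_full sl l0.
(* The recursion of [seq_full] moves its starting point, hence the generalization over it. *)
move: (_.-1) (h q0) => k; elim: k => [|k IH] q /=.
  by rewrite c0; case: eqP => //= _; apply/esym/forallP => -[].
have Eq := c0 q.
have -> : [forall j : 'I_k.+1, iter j h q != q0]
        = (q != q0) && [forall j : 'I_k, iter j h (h q) != q0].
  apply/forallP/andP => [a|[q1 /forallP a] [[|j] jk] //].
    split; first exact: a ord0.
    by apply/forallP => j; rewrite -iterSr; apply: (a (lift ord0 j)).
  by have := a (Ordinal (jk : j < k)); rewrite -iterSr.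
rewrite -Eq andbCA -iterS iterSr lh IH.
by case: (code q).
Qed.

Section Reflection.
Variables (n N : nat) (lw le : seq nat).
Let m := 3 * n.+1.
Hypothesis ok : plug_ok m N.+1 lw le.
Let w := @w_of n N lw.
Let el := @el_of n N le.

Definition wcode (v : port n.+1 + 'I_N.+1) : nat :=
  match v with inl p => code p | inr a => m + a end.

Lemma wcodeE o : wcode (w o) = nth 0 lw (code o).
Proof.
have /and5P[/eqP sw _ _ _ aw] := ok.
rewrite /w /w_of; case: ifP => [v|v] /=; first by rewrite decodeK.
have lt : nth 0 lw (code o) < m + N.+1.
  by apply: (allP aw); rewrite mem_nth // sw code_lt.
by rewrite inordK; lia.
Qed.

Lemma elcodeE a : code (el a) = nth 0 le a.
Proof.
have /and5P[_ /eqP se _ /allP ae _] := ok.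
by rewrite decodeK //; apply: ae; rewrite mem_nth // se.
Qed.

Lemma plug_okP : plugging w el.
Proof.
have /and5P[/eqP sw /eqP se u /allP ae /allP aw] := ok.
have /and3P[uw dis ue] : [&& uniq lw, ~~ has (mem lw) le & uniq le].
  by rewrite -cat_uniq.
(* [lw ++ le] consists of [m + N.+1] distinct numbers below [m + N.+1], so every such number
   occurs. *)
have mem_all v : v < m + N.+1 -> v \in lw ++ le.
  have sub : {subset lw ++ le <= iota 0 (m + N.+1)}.
    move=> x; rewrite mem_cat mem_iota add0n /= => /orP[/aw//|/ae xm].
    by apply: leq_trans xm _; apply: leq_addr.
  have [|_ ->] := uniq_min_size u sub; last by rewrite mem_iota.
  by rewrite size_iota size_cat sw se.
have w_cod v : v \in lw -> exists o, wcode (w o) = v.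
  move=> vw; have lt : index v lw < 3 * n.+1 by rewrite -/m -sw index_mem.
  by exists (decode n (index v lw)); rewrite wcodeE decodeK // nth_index.
have wcode_inj : injective wcode.
  move=> [p|a] [q|b] /=; last by move=> E; congr inr; apply: val_inj => /=; lia.
  - by move/code_inj->.
  - by have := code_lt p; rewrite -/m; lia.
  - by have := code_lt q; rewrite -/m; lia.
split.
- move=> o o' E; apply: code_inj; apply/eqP.
  by rewrite -(nth_uniq 0 _ _ uw) ?sw ?code_lt // -!wcodeE E.
- move=> a b /(congr1 (@code _)); rewrite !elcodeE => E; apply/val_inj/eqP.
  by rewrite -(nth_uniq 0 _ _ ue) ?se //= E.
- move=> o a E; case/hasP: dis; exists (code (el a)).
    by rewrite elcodeE mem_nth // se.
  by rewrite /= -[code _]/(wcode (inl (el a))) -E wcodeE mem_nth // sw code_lt.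
- move=> p; have := mem_all (code p).
  rewrite mem_cat => /(_ (leq_trans (code_lt p) (leq_addr _ _)))/orP[|pe].
    by case/w_cod => o Eo; right; exists o; apply: wcode_inj.
  left; have lt : index (code p) le < N.+1 by rewrite -se index_mem.
  exists (Ordinal lt); apply: code_inj.
  by rewrite elcodeE nth_index.
- move=> a; have := mem_all (m + a); rewrite ltn_add2l ltn_ord mem_cat => /(_ isT).
  case/orP => [/w_cod[o Eo]|/ae]; last by lia.
  by exists o; apply: wcode_inj.
Qed.

Lemma covbE (y : 'S_N.+1) :
  covb (turn_lists n.+1) m lw le (perm_seq y) = covers w el y.
Proof.
have /and5P[/eqP sw _ _ _ _] := ok.
have linkE o : nth 0 (glue_list m lw le (perm_seq y)) (code o) = code (link w el y o).
  rewrite (nth_map 0) ?sw ?code_lt // -wcodeE /link.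
  case: (w o) => [p|a] /=; first by rewrite -/m code_lt.
  by rewrite ltnNge leq_addr /= addKn nth_perm_seq elcodeE.
have fullE c : seq_full [seq nth 0 (glue_list m lw le (perm_seq y)) o | o <- turn_list n.+1 c]
    = (fcard (hop w el y (fun k => nth false c k)) predT == 1).
  apply: seq_fullE.
  - exact: (hop_inj (c := fun k => nth false c k) plug_okP (@perm_inj _ y)).
  - by rewrite size_map size_turn_list.
  - move=> q; rewrite (nth_map 0) ?size_turn_list ?code_lt //.
    by rewrite nth_turn_list linkE.
rewrite /covb has_map; apply/hasP/existsP => [[c _ /=]|[c f1]].
  rewrite fullE => f1; exists [ffun k : 'I_n.+1 => nth false c k].
  apply/eqP; rewrite -[RHS](eqP f1); apply: eq_fcard => q.
  by rewrite /hop ffunE.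
exists [seq c k | k <- enum 'I_n.+1].
  by rewrite mem_bool_seqs size_map size_enum_ord.
rewrite /= fullE; apply/eqP; rewrite -[RHS](eqP f1); apply: eq_fcard => q.
by rewrite /hop (nth_map q.1) ?size_enum_ord // nth_ord_enum.
Qed.

End Reflection.

(** * The finite check *)

Lemma perm_seq_permutations N (y : 'S_N) : perm_seq y \in permutations (iota 0 N).
Proof.
rewrite mem_permutations; apply: uniq_perm; rewrite ?iota_uniq //.
  by rewrite map_inj_uniq ?enum_uniq // => a b /val_inj/perm_inj.
move=> v; rewrite mem_iota add0n /=; apply/mapP/idP => [[a _ ->]|lt_v].
  exact: ltn_ord.
by exists (y^-1 (Ordinal lt_v))%g; rewrite ?mem_enum // permKV.
Qed.

Lemma permutations_perm_seq N ly : ly \in permutations (iota 0 N.+1) ->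
  exists y : 'S_N.+1, perm_seq y = ly.
Proof.
rewrite mem_permutations => p_ly; have sz : size ly = N.+1.
  by rewrite (perm_size p_ly) size_iota.
have lt (a : 'I_N.+1) : nth 0 ly a < N.+1.
  by have := mem_nth 0 (s := ly) (n := a); rewrite (perm_mem p_ly) mem_iota sz; apply.
have u : uniq ly by rewrite (perm_uniq p_ly) iota_uniq.
have f_inj : injective (fun a : 'I_N.+1 => Ordinal (lt a)).
  move=> a b [] E; apply/val_inj/eqP.
  by rewrite -(@nth_uniq _ 0 ly a b) ?sz ?ltn_ord // E.
exists (perm f_inj); apply: (@eq_from_nth _ 0) => [|i].
  by rewrite size_map size_enum_ord sz.
rewrite size_map size_enum_ord => lt_i.
by rewrite -[i]/(nat_of_ord (Ordinal lt_i)) nth_perm_seq permE.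
Qed.

Definition turns2 := Eval compute in turn_lists 2.
Definition turns3 := Eval compute in turn_lists 3.
Definition perms3 := Eval compute in permutations (iota 0 3).
Definition perms4 := Eval compute in permutations (iota 0 4).

(** A truth table over all routes, so that finding a suitable pair for a triple becomes membership
    in a list of tables. *)
Definition cov tl ps m (c : seq nat * seq nat) : seq bool :=
  [seq covb tl m c.1 c.2 ly | ly <- ps].

(* Pairs of hexagons with 3 respectively 4 exits; in the second one for 3
   exits, a hexagon is plugged into itself. *)
Definition pairs3 : seq (seq nat * seq nat) :=
  [seq (c.1, le) | c <- [:: ([:: 6; 7; 8; 0; 1; 2], [:: 3; 4; 5]);
                            ([:: 6; 7; 0; 8; 1; 3], [:: 2; 4; 5])],
                   le <- permutations c.2].
Definition pairs4 : seq (seq nat * seq nat) :=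
  [seq (c.1, le) | c <- [:: ([:: 6; 7; 8; 9; 0; 1], [:: 2; 3; 4; 5]);
                            ([:: 6; 7; 3; 8; 9; 0], [:: 1; 2; 4; 5])],
                   le <- permutations c.2].

Definition covs3 := Eval compute in undup [seq cov turns2 perms3 6 c | c <- pairs3].
Definition covs4 := Eval compute in undup [seq cov turns2 perms4 6 c | c <- pairs4].

(** The default 3 is the number of the context; it is the value at 9, the code of an unglued
    port. *)
Definition hex_of (v : nat) := nth 3 [:: 0; 0; 0; 1; 1; 1; 2; 2; 2] v.

(* A triple of hexagons is listed by the codes of the input ports to which the
   nine output ports are glued, with 9 for those that are not glued. *)
Fixpoint ext_from (b : nat) (lm : seq nat) : seq nat :=
  if lm is v :: lm' then
    if v < 9 then v :: ext_from b lm' else b :: ext_from b.+1 lm'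
  else [::].

Definition ext_list := ext_from 9.

Definition free_list (lm : seq nat) := [seq v <- iota 0 9 | v \notin lm].

Definition num_between k k' (lm : seq nat) :=
  count (fun i => let h := hex_of (nth 9 lm i) in
           if hex_of i == k then h == k' else if hex_of i == k' then h == k else false)
        (iota 0 (size lm)).

(* Renumbering the ports of a hexagon permutes its three keys, so that the keys
   may be assumed to be sorted. *)
Definition key (lm : seq nat) i := 4 * hex_of (nth 9 lm i) + hex_of (index i lm).

Definition key_sorted lm :=
  all (fun i => key lm i <= key lm i.+1) [:: 0; 1; 3; 4; 6; 7].

(** Pruning by conditions that a prefix can decide. The input part of a key needs the whole list, so
    within the three ports of a hexagon only the output parts are compared here. Nested conditionals
    make the evaluation stop early. *)
Definition ok_next (pre : seq nat) (v : nat) :=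
  let j := size pre in
  if hex_of v == hex_of j then false else
  if (if j \in [:: 0; 3; 6] then true else hex_of (last 0 pre) <= hex_of v) then
    if v == 9 then true else
    if v \in pre then false else num_between (hex_of j) (hex_of v) pre < 2
  else false.

(** Lists with more than four exits or unsorted keys are outside the claim and count as checked.
    Fewer than three exits give [false], so the success of the search includes the bound of six
    gluings. *)
Definition leaf (lm : seq nat) :=
  let c := (ext_list lm, free_list lm) in
  let N := count (leq 9) lm in
  if 4 < N then true else if ~~ key_sorted lm then true else
  if ~~ plug_ok 9 N c.1 c.2 then false else
  if N == 3 then let s := cov turns3 perms3 9 c in s \in covs3 else
  if N == 4 then let s := cov turns3 perms4 9 c in s \in covs4 else false.

Fixpoint explore k pre :=
  if k is k'.+1 then
    all (fun v => if ok_next pre v then explore k' (rcons pre v) else true) (iota 0 10)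
  else leaf pre.

Lemma explore_all : explore 9 [::].
Proof. by vm_compute. Qed.

Lemma explore_leaf k lm : k <= size lm -> explore k (take (size lm - k) lm) ->
  (forall j, j < size lm -> nth 9 lm j <= 9 /\ ok_next (take j lm) (nth 9 lm j)) ->
  leaf lm.
Proof.
elim: k => [|k IH] klm; first by rewrite subn0 take_size.
set j := size lm - k.+1; have jlm : j < size lm by lia.
move=> /(@allP _ _ (iota 0 10)) ex ok; have [v9 okj] := ok j jlm.
have := ex (nth 9 lm j); rewrite mem_iota add0n ltnS v9 okj => /(_ isT) exj.
apply: IH ok; first by lia.
have -> : size lm - k = j.+1 by lia.
by rewrite (take_nth 9).
Qed.

Record valid_triple (lm : seq nat) : Prop := ValidTriple {
  vt_size : size lm = 9;
  vt_le9 : forall i, nth 9 lm i <= 9;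
  vt_clean : forall i, i < 9 -> hex_of (nth 9 lm i) != hex_of i;
  vt_inj : forall i j, i < j < 9 -> nth 9 lm i = nth 9 lm j -> nth 9 lm j = 9;
  vt_sorted : key_sorted lm;
  vt_pairs : forall k k', k < k' < 3 -> num_between k k' lm <= 2;
  vt_free : count (leq 9) lm <= 4 }.

Lemma num_betweenC k k' lm : num_between k k' lm = num_between k' k lm.
Proof.
apply: eq_count => i /=; case: (eqVneq (hex_of i) k) => [<-|_];
  by case: (eqVneq (hex_of i) k') => [E|_]; rewrite -?E.
Qed.

Lemma valid_leaf lm : valid_triple lm -> leaf lm.
Proof.
case=> sz le9 clean inj srt prs _.
have := @explore_leaf 9 lm; rewrite sz subnn take0 => /(_ isT explore_all); apply.
move=> j j9; split; first exact: le9.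
rewrite /ok_next size_take sz j9.
have hle3 v : hex_of v <= 3 by do 10?[case: v => [|v] //]; case: v.
rewrite (negPf (clean j j9)); have -> : (if j \in [:: 0; 3; 6] then true
    else hex_of (last 0 (take j lm)) <= hex_of (nth 9 lm j)).
  case: ifP => //; case: j j9 => // j j9 nj.
  have j8 : j < 9 := ltnW j9; rewrite (take_nth 9) ?sz // last_rcons.
  (* The low part of a key is below 4, so sorted keys have sorted output parts. *)
  have : key lm j <= key lm j.+1.
    by apply: (allP srt j); move: nj j9; rewrite !inE; lia.
  rewrite /key; have := hle3 (index j lm); have := hle3 (index j.+1 lm); lia.
case: eqP => // v9; case: ifP => [|_].
  case/(nthP 9) => i; rewrite size_take sz j9 => ij; rewrite nth_take // => E.
  by case: v9; apply: (inj i j) => //; rewrite ij.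
set k := hex_of j; set k' := hex_of (nth 9 lm j).
have lt3 v : v < 9 -> hex_of v < 3 by do 9?[case: v => [|v] //].
have k3 : k < 3 by apply: lt3.
have k'3 : k' < 3.
  by apply: lt3; have := le9 j; lia.
have kk' : k' != k by apply: clean.
have le2 : num_between k k' lm <= 2.
  case: (ltngtP k k') kk' => // lt _; first by apply: prs; rewrite lt.
  by rewrite num_betweenC; apply: prs; rewrite lt.
apply: leq_trans le2; rewrite /num_between size_take sz j9.
(* Entry [j] is itself a gluing between [k] and [k'], so the prefix before it has strictly fewer
   than the whole list. *)
have E9 : iota 0 9 = iota 0 j ++ j :: iota j.+1 (9 - j.+1).
  rewrite -[j :: _]/(iota j (9 - j.+1).+1) subnSK //.
  by rewrite -{2}[j]add0n -iotaD subnKC // ltnW.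
rewrite E9 count_cat /= -/k -/k' !eqxx addnA addn1.
rewrite ltnS; apply: leq_trans (leq_addr _ _); apply: eq_leq.
apply: eq_in_count => i; rewrite mem_iota add0n /= => ij.
by rewrite nth_take.
Qed.

Lemma tripleP lm : valid_triple lm -> exists N lw' le',
  [/\ plug_ok 9 N.+1 (ext_list lm) (free_list lm), plug_ok 6 N.+1 lw' le',
      forall y : 'S_N.+1,
        covers (@w_of 2 N (ext_list lm)) (@el_of 2 N (free_list lm)) y
        = covers (@w_of 1 N lw') (@el_of 1 N le') y
    & exists y : 'S_N.+1, covers (@w_of 1 N lw') (@el_of 1 N le') y ].
Proof.
move=> vt; have := valid_leaf vt; rewrite /leaf ltnNge (vt_free vt) (vt_sorted vt) /=.
case: ifP => // /negbFE.
(* The condition [has id] asks every table of a pair to contain [true]: this supplies the common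
   route on which oddness rests. *)
have cov_eq N ps (pairs : seq (seq nat * seq nat)) covs :
    ps = permutations (iota 0 N.+1) ->
    covs = undup [seq cov turns2 ps 6 c | c <- pairs] ->
    all (fun c => plug_ok 6 N.+1 c.1 c.2 && has id (cov turns2 ps 6 c)) pairs ->
    plug_ok 9 N.+1 (ext_list lm) (free_list lm) ->
    cov turns3 ps 9 (ext_list lm, free_list lm) \in covs ->
    exists N lw' le',
  [/\ plug_ok 9 N.+1 (ext_list lm) (free_list lm), plug_ok 6 N.+1 lw' le',
      forall y : 'S_N.+1,
        covers (@w_of 2 N (ext_list lm)) (@el_of 2 N (free_list lm)) y
        = covers (@w_of 1 N lw') (@el_of 1 N le') y
    & exists y : 'S_N.+1, covers (@w_of 1 N lw') (@el_of 1 N le') y ].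
  move=> Eps -> /allP a ok; rewrite mem_undup => /mapP[[lw' le'] /a/andP[/= ok' hs] Ec].
  exists N, lw', le'; split=> // [y|].
    rewrite -(@covbE 2 N _ _ ok) -(@covbE 1 N _ _ ok').
    rewrite -[turn_lists 3]/turns3 -[turn_lists 2]/turns2.
    have := perm_seq_permutations y; rewrite -Eps => yps.
    have lt : index (perm_seq y) ps < size ps by rewrite index_mem.
    have := congr1 (nth false ^~ (index (perm_seq y) ps)) Ec.
    by rewrite !(nth_map [::]) // nth_index.
  case/hasP: hs => _ /mapP[ly lyps ->] /= cy; move: lyps; rewrite Eps.
  case/permutations_perm_seq => y Ey; exists y.
  by rewrite -(@covbE 1 N _ _ ok') Ey.
move: (count _ _) => N ok; case: ifP => [/eqP EN|_].
  rewrite EN in ok => mem.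
  by apply: (cov_eq 2 perms3 pairs3 covs3 _ _ _ ok mem); vm_compute.
case: ifP => [/eqP EN|//]; rewrite EN in ok => mem.
by apply: (cov_eq 3 perms4 pairs4 covs4 _ _ _ ok mem); vm_compute.
Qed.

(** * The hexagons of G *)

Section HexagonLabels.
Variables (G : digraph) (tau sig : darc G -> darc G).
Hypotheses (pr : pairing tau sig) (hx : hexagonal tau sig).
Local Notation alt := (alt tau sig).
Local Notation st := (two_steps tau sig).

Lemma alt_st e j : alt (st e) j = alt e j.+2.
Proof. by elim: j => //= j ->; rewrite !negbK. Qed.

Lemma alt6 e j : alt e (j + 6) = alt e j.
Proof. by rewrite addnC -[6 + j]/(j.+2.+2.+2) -!alt_st (hx e).2. Qed.

(* The ports of a hexagon are numbered so that every input port is joined to the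
   two output ports whose numbers differ from its own. *)
Definition input e (i : 'I_3) : G := src (alt e i.*2.+1).
(** Position [2i + 4] is opposite to position [2i + 1]. It may exceed 5 and is then read modulo
    6. *)
Definition output e (i : 'I_3) : G := tgt (alt e i.*2.+4).
Definition port_arc e (z : 'I_3 * bool) : darc G := alt e (z.1.*2 + z.2).+1.

Lemma src_alt e j : odd j -> src (alt e j.+1) = src (alt e j).
Proof. by move=> /= ->; rewrite (src_sig pr). Qed.

Lemma tgt_alt e j : ~~ odd j -> tgt (alt e j.+1) = tgt (alt e j).
Proof. by move=> /= /negPf ->; rewrite (tgt_tau pr). Qed.

Lemma src_port_arc e z : src (port_arc e z) = input e z.1.
Proof.
case: z => i b; rewrite /port_arc /input [_.1]/= [_.2]/=.
case: b; rewrite ?addn0 // addn1 (src_alt e (j := i.*2.+1)) //=.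
by rewrite odd_double.
Qed.

Lemma tgt_port_arc e z : tgt (port_arc e z) = output e (rot3 z.2 z.1).
Proof.
have e6 : alt e 6 = alt e 0 := alt6 e 0.
have e8 : alt e 8 = alt e 2 := alt6 e 2.
rewrite /port_arc /output; case: z => -[[|[|[|//]]] ?] [].
- by change (tgt (alt e 2) = tgt (alt e 8)); rewrite e8.
- by change (tgt (alt e 1) = tgt (alt e 6)); rewrite e6 tgt_alt.
- by [].
- by change (tgt (alt e 3) = tgt (alt e 8)); rewrite e8 tgt_alt.
- by [].
- by change (tgt (alt e 5) = tgt (alt e 4)); rewrite tgt_alt.
Qed.

Lemma port_arc_inj e : injective (port_arc e).
Proof.
have [/mkseq_uniqP u e6] := hexagon_uniq pr hx e.
(* The arcs of the ports have indices 1 to 6, and index 6 is index 0 again. *)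
pose ix (z : 'I_3 * bool) := if (z.1.*2 + z.2).+1 == 6 then 0 else (z.1.*2 + z.2).+1.
have ixE z : port_arc e z = alt e (ix z).
  by rewrite /port_arc /ix; case: eqP => // ->.
have ix6 z : ix z < 6.
  by case: z => [[[|[|[|//]]] ?] []].
move=> z z'; rewrite !ixE => /u; rewrite !inE !ix6 => /(_ isT isT).
by case: z => [[[|[|[|//]]] ?] []]; case: z' => [[[|[|[|//]]] ?] []] // _;
  congr (_, _); apply: val_inj.
Qed.

Lemma mem_port_arc e f : (f \in hexagon tau sig e) = (f \in codom (port_arc e)).
Proof.
have [u e6] := hexagon_uniq pr hx e.
have sub : {subset codom (port_arc e) <= hexagon tau sig e}.
  move=> _ /codomP[[i b] ->]; change (alt e (i.*2 + b).+1 \in hexagon tau sig e).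
  have [->|ne] := eqVneq (i.*2 + b).+1 6; first by rewrite e6 mem_hexagon.
  apply/mapP; exists (i.*2 + b).+1 => //; rewrite mem_iota /=.
  by have := ltn_ord i; case: b ne; lia.
have uc : uniq (codom (port_arc e)).
  by rewrite map_inj_uniq ?enum_uniq //; apply: port_arc_inj.
have [|_ ->] := uniq_min_size uc sub; last by [].
by rewrite size_codom card_prod card_ord card_bool size_mkseq.
Qed.

Lemma input_inj e : injective (input e).
Proof.
move=> i j; rewrite -(src_port_arc e (i, false)) -(src_port_arc e (j, false)) => E.
have [/port_arc_inj[->//]|ne] := eqVneq (port_arc e (i, false)) (port_arc e (j, false)).
have : port_arc e (j, false) == sig (port_arc e (i, false)).
  by rewrite -(co_srcE pr) ne E eqxx.
have -> : sig (port_arc e (i, false)) = port_arc e (i, true).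
  by rewrite /port_arc /= addn0 addn1 /= odd_double.
by move/eqP/port_arc_inj.
Qed.

Lemma output_inj e : injective (output e).
Proof.
suff out_inj k l : output e (rot3 false k) = output e (rot3 false l) -> k = l.
  by move=> i j; rewrite -{1}(rot3K true i) -{1}(rot3K true j) => /out_inj/rot3_inj.
rewrite -(tgt_port_arc e (k, false)) -(tgt_port_arc e (l, false)) => E.
have [/port_arc_inj[->//]|ne] := eqVneq (port_arc e (k, false)) (port_arc e (l, false)).
have : port_arc e (l, false) == tau (port_arc e (k, false)).
  by rewrite -(co_tgtE pr) ne E eqxx.
have -> : tau (port_arc e (k, false)) = port_arc e (rot3 true k, true).
  case: k {E ne} => [[|[|[|//]]] ?].
  - by change (tau (tau e) = alt e (0 + 6)); rewrite alt6 (tauK pr).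
  - by change (tau (tau (alt e 2)) = alt e 2); rewrite (tauK pr).
  - by change (tau (tau (alt e 4)) = alt e 4); rewrite (tauK pr).
by move/eqP/port_arc_inj.
Qed.

Lemma input_st e : (input (st e) (inord 0) = input e (inord 1))
  * (input (st e) (inord 1) = input e (inord 2))
  * (input (st e) (inord 2) = input e (inord 0)).
Proof. by rewrite /input !alt_st !inordK // -[7]/(1 + 6) alt6. Qed.

Lemma output_st e : (output (st e) (inord 0) = output e (inord 1))
  * (output (st e) (inord 1) = output e (inord 2))
  * (output (st e) (inord 2) = output e (inord 0)).
Proof. by rewrite /output !alt_st !inordK // -[10]/(4 + 6) alt6. Qed.

(** Starting at [tau e] reverses the direction of the traversal, which makes reflections of the port
    numbering available. *)
Lemma alt_tau e j : j <= 7 -> alt (tau e) j = alt e (7 - j).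
Proof.
elim: j => [_|j IH j7]; first by rewrite subn0 -[7]/(1 + 6) alt6.
rewrite /= IH 1?ltnW // -[7 - j.+1]/(6 - j) subSn //= oddB //=.
by case: (odd j) => /=; rewrite ?(sigK pr) ?(tauK pr).
Qed.

Lemma input_tau e : (input (tau e) (inord 0) = input e (inord 2))
  * (input (tau e) (inord 1) = input e (inord 1))
  * (input (tau e) (inord 2) = input e (inord 0)).
Proof.
rewrite /input !inordK // -[(0.*2).+1]/1 -[(1.*2).+1]/3 -[(2.*2).+1]/5 !alt_tau //.
by rewrite (src_alt e (j := 5)) // (src_alt e (j := 3)) // (src_alt e (j := 1)).
Qed.

Lemma output_tau e : (output (tau e) (inord 0) = output e (inord 2))
  * (output (tau e) (inord 1) = output e (inord 1))
  * (output (tau e) (inord 2) = output e (inord 0)).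
Proof.
have E8 f : alt f 8 = alt f 2 := alt6 f 2.
rewrite /output !inordK // -[(1.*2).+4]/6 -[(0.*2).+4]/4 -[(2.*2).+4]/8 !E8 !alt_tau //.
by rewrite (tgt_alt e (j := 2)) // (tgt_alt e (j := 4)) //
  (tgt_alt e (j := 0)) // (alt6 e 0 : alt e 6 = _).
Qed.

(** [st] rotates the three port numbers and [tau] swaps 0 with 2. The six possible first arcs thus
    realize all orders of the three keys, and one of them is sorted. *)
Lemma sorted_labels (A : {set darc G}) (kappa : G -> G -> nat) : A \in ACs G ->
  exists2 e, e \in A & 
    let k i := kappa (input e (inord i)) (output e (inord i)) in k 0 <= k 1 <= k 2.
Proof.
move=> AC; have [e0 [n [EA _ _ n0 _]]] := AC_alt pr AC.
have eA : e0 \in A by rewrite EA inE; apply/mapP; exists 0; rewrite ?mem_iota.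
move: (e0) eA => e eA {n n0 EA e0}.
have tA f : f \in A -> tau f \in A by move=> fA; case: (AC_closed pr AC fA).
have sA f : f \in A -> st f \in A by move=> /tA fA; case: (AC_closed pr AC fA).
pose k f i := kappa (input f (inord i)) (output f (inord i)).
suff [f fA kf] : exists2 f, f \in A & k f 0 <= k f 1 <= k f 2 by exists f.
have kst f : [/\ k (st f) 0 = k f 1, k (st f) 1 = k f 2 & k (st f) 2 = k f 0].
  by rewrite /k !input_st !output_st.
have kt f : [/\ k (tau f) 0 = k f 2, k (tau f) 1 = k f 1 & k (tau f) 2 = k f 0].
  by rewrite /k !input_tau !output_tau.
have [a0 a1 a2] := kst e; have [b0 b1 b2] := kst (st e).
have [c0 c1 c2] := kt e; have [d0 d1 d2] := kt (st e); have [f0 f1 f2] := kt (st (st e)).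
have [h|h] := boolP (k e 0 <= k e 1 <= k e 2); first by exists e.
have [h1|h1] := boolP (k (st e) 0 <= k (st e) 1 <= k (st e) 2); first by exists (st e); auto.
have [h2|h2] := boolP (k (st (st e)) 0 <= k (st (st e)) 1 <= k (st (st e)) 2).
  by exists (st (st e)); auto.
have [h3|h3] := boolP (k (tau e) 0 <= k (tau e) 1 <= k (tau e) 2); first by exists (tau e); auto.
have [h4|h4] := boolP (k (tau (st e)) 0 <= k (tau (st e)) 1 <= k (tau (st e)) 2).
  by exists (tau (st e)); auto.
exists (tau (st (st e))); first by auto.
lia.
Qed.

End HexagonLabels.

Definition ports : seq (port 3) := [seq decode 2 j | j <- iota 0 9].

Lemma code_ports : [seq code o | o <- ports] = iota 0 9.
Proof.
rewrite -map_comp -[RHS]map_id; apply/eq_in_map => j; rewrite mem_iota => j9 /=.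
by rewrite decodeK.
Qed.

Lemma ports_uniq : uniq ports.
Proof. by rewrite -(map_inj_uniq (@code_inj 3)) code_ports iota_uniq. Qed.

Lemma mem_ports o : o \in ports.
Proof.
by apply/mapP; exists (code o); rewrite ?codeK // mem_iota add0n (code_lt o).
Qed.

Lemma count_ports (P : pred (port 3)) : count P ports = #|P|.
Proof.
rewrite cardE -size_filter; apply/perm_size/uniq_perm;
  rewrite ?enum_uniq ?filter_uniq ?ports_uniq //.
by move=> o; rewrite mem_filter mem_ports andbT mem_enum.
Qed.

Lemma hex_of_code (p : port 3) : hex_of (code p) = p.1.
Proof. by case: p => [[[|[|[|//]]] ?] [[|[|[|//]]] ?]]. Qed.

(** * The gluing list of three hexagons of a digraph *)

Section Triple.
Variables (G : digraph) (tau sig : darc G -> darc G).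
Hypotheses (pr : pairing tau sig) (hx : hexagonal tau sig).
Variable A : 'I_3 -> {set darc G}.
Hypotheses (A_inj : injective A) (A_AC : forall k, A k \in ACs G).

Lemma A_uniq k k' f : f \in A k -> f \in A k' -> k = k'.
Proof.
move=> fk fk'; apply: A_inj.
by rewrite (AC_hexagon pr hx (A_AC k) fk) (AC_hexagon pr hx (A_AC k') fk').
Qed.

(** Defined through vertices alone, without port numbers: the first arcs [E] are chosen by sorting
    keys made of [otype] and [itype], so these must not depend on [E]. As in [hex_of], 3 stands for
    the context. *)
Definition otype (v : G) : nat :=
  if [pick k | [exists f in A k, src f == v]] is Some k then k : nat else 3.
Definition itype (v : G) : nat :=
  if [pick k | [exists f in A k, tgt f == v]] is Some k then k : nat else 3.

Variable E : 'I_3 -> darc G.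
Hypothesis E_in : forall k, E k \in A k.

Definition in_port (q : port 3) : G := input tau sig (E q.1) q.2.
Definition out_port (q : port 3) : G := output tau sig (E q.1) q.2.
Definition triple_arc (x : port 3 * bool) : darc G :=
  port_arc tau sig (E x.1.1) (x.1.2, x.2).

Lemma memA k f : (f \in A k) = (f \in codom (port_arc tau sig (E k))).
Proof. by rewrite (AC_hexagon pr hx (A_AC k) (E_in k)) inE mem_port_arc. Qed.

Lemma triple_arc_in x : triple_arc x \in A x.1.1.
Proof. by rewrite memA; apply: codom_f. Qed.

Lemma memA_triple_arc k f : f \in A k -> exists i b, f = triple_arc ((k, i), b).
Proof. by rewrite memA => /codomP[[i b] ->]; exists i, b. Qed.

Lemma src_triple_arc x : src (triple_arc x) = in_port x.1.
Proof. by rewrite src_port_arc. Qed.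

Lemma tgt_triple_arc x : tgt (triple_arc x) = out_port (turn x.2 x.1).
Proof. by rewrite tgt_port_arc. Qed.

Lemma triple_arc_inj : injective triple_arc.
Proof.
move=> [[k i] b] [[k' i'] b'] Ex.
have Ek : k = k' by apply: (A_uniq (triple_arc_in ((k, i), b))); rewrite Ex; apply: triple_arc_in.
by move: Ex; rewrite Ek => /(port_arc_inj pr hx)[-> ->].
Qed.

Lemma src_in_port e p : src e = in_port p -> e \in A p.1.
Proof.
rewrite -(src_triple_arc (p, true)) => Es.
have [->|ne] := eqVneq e (triple_arc (p, true)); first exact: triple_arc_in.
have /eqP -> : e == sig (triple_arc (p, true)) by rewrite -(co_srcE pr) eq_sym ne Es eqxx.
exact: (AC_closed pr (A_AC _) (triple_arc_in (p, true))).2.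
Qed.

Lemma out_port_tgt o : out_port o = tgt (triple_arc (turn true o, false)).
Proof. by rewrite tgt_triple_arc /= -[false]/(~~ true) turnK. Qed.

Lemma tgt_out_port e o : tgt e = out_port o -> e \in A o.1.
Proof.
rewrite out_port_tgt => Es; set x := (_, _) in Es.
have [->|ne] := eqVneq e (triple_arc x); first exact: (triple_arc_in x).
have /eqP -> : e == tau (triple_arc x) by rewrite -(co_tgtE pr) eq_sym ne Es eqxx.
exact: (AC_closed pr (A_AC _) (triple_arc_in x)).1.
Qed.

Lemma in_port_inj : injective in_port.
Proof.
move=> [k i] [k' i'] Ei.
have Ek : k = k'.
  apply: (A_uniq (triple_arc_in ((k, i), true))).
  by apply: (@src_in_port _ (k', i')); rewrite src_triple_arc.
by move: Ei; rewrite Ek => /(input_inj pr hx) /= ->.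
Qed.

Lemma out_port_inj : injective out_port.
Proof.
move=> [k i] [k' i'] Ei.
have Ek : k = k'.
  apply: (A_uniq (triple_arc_in (turn true (k, i), false))).
  by apply: (@tgt_out_port _ (k', i')); rewrite -Ei -out_port_tgt.
by move: Ei; rewrite Ek => /(output_inj pr hx) /= ->.
Qed.

Lemma otype_in_port p : otype (in_port p) = p.1.
Proof.
rewrite /otype; case: pickP => [k /exists_inP[f fk /eqP/src_in_port fp]|/(_ p.1)].
  by rewrite (A_uniq fk fp).
by case/exists_inP; exists (triple_arc (p, true)); rewrite ?triple_arc_in // src_triple_arc.
Qed.

Lemma itype_out_port o : itype (out_port o) = o.1.
Proof.
rewrite /itype; case: pickP => [k /exists_inP[f fk /eqP/tgt_out_port fp]|/(_ o.1)].
  by rewrite (A_uniq fk fp).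
case/exists_inP; exists (triple_arc (turn true o, false)); rewrite -?out_port_tgt //.
exact: (triple_arc_in (turn true o, false)).
Qed.

Lemma otype3 v : (forall p, v <> in_port p) -> otype v = 3.
Proof.
move=> no; rewrite /otype; case: pickP => // k /exists_inP[f /memA_triple_arc[i [b ->]]].
by rewrite src_triple_arc => /eqP/esym/no.
Qed.

Lemma itype3 v : (forall o, v <> out_port o) -> itype v = 3.
Proof.
move=> no; rewrite /itype; case: pickP => // k /exists_inP[f /memA_triple_arc[i [b ->]]].
by rewrite tgt_triple_arc => /eqP/esym/no.
Qed.

Definition glue_code (o : port 3) : nat :=
  if [pick p | in_port p == out_port o] is Some p then code p else 9.

Lemma glue_codeP o :
  (exists2 p, out_port o = in_port p & glue_code o = code p) \/
  ((forall p, out_port o <> in_port p) /\ glue_code o = 9).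
Proof.
rewrite /glue_code; case: pickP => [p /eqP Ep|no]; [left; exists p|right] => //.
by split=> // p Ep; have := no p; rewrite Ep eqxx.
Qed.

Lemma glue_code_in_port o p : out_port o = in_port p -> glue_code o = code p.
Proof.
case: (glue_codeP o) => [[q -> ->] /in_port_inj ->|[no _] /no] //.
Qed.

Lemma glue_code_lt o p : glue_code o = code p -> out_port o = in_port p.
Proof.
have := code_lt p; case: (glue_codeP o) => [[q -> ->] _ /code_inj ->|[_ ->] l E9] //.
by rewrite -E9 in l.
Qed.

Definition glue_codes := [seq glue_code o | o <- ports].

Lemma nth_glue_codes o : nth 9 glue_codes (code o) = glue_code o.
Proof.
have lt : code o < size (iota 0 9) by rewrite size_iota (code_lt o).
rewrite (nth_map o) ?size_map // (nth_map 0) // nth_iota ?(code_lt o) //.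
by rewrite add0n codeK.
Qed.

Lemma code_decode j : j < 9 -> exists o : port 3, j = code o.
Proof. by move=> j9; exists (decode 2 j); rewrite decodeK. Qed.

(** The sorting done on vertices is the one that the search assumes. The code of an unglued input
    port is missing from the list, and its [index] is then the length 9, which [hex_of] sends to
    3. *)
Lemma key_code o : key glue_codes (code o) = 4 * otype (out_port o) + itype (in_port o).
Proof.
rewrite /key nth_glue_codes; congr (4 * _ + _).
  case: (glue_codeP o) => [[p -> ->]|[no ->]]; first by rewrite hex_of_code otype_in_port.
  by rewrite otype3.
have sz : size glue_codes = 9 by rewrite !size_map size_iota.
have [|nin] := boolP (code o \in glue_codes).
  case/(nthP 9) => j; rewrite sz => /code_decode[o' ->].
  rewrite nth_glue_codes => /glue_code_lt Eo'.
  have -> : index (code o) glue_codes = code o'.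
    have jlt : index (code o) glue_codes < 9.
      rewrite -sz index_mem; apply/(nthP 9); exists (code o').
        by rewrite sz (code_lt o').
      by rewrite nth_glue_codes (glue_code_in_port Eo').
    have [o1 E1] := code_decode jlt; rewrite E1; congr code.
    apply: out_port_inj; rewrite Eo'; apply: glue_code_lt.
    by rewrite -nth_glue_codes -E1 nth_index // -index_mem sz.
  by rewrite hex_of_code -Eo' itype_out_port.
rewrite memNindex // sz itype3 // => o' Eo'.
case/negP: nin; apply/(nthP 9); exists (code o'); first by rewrite sz (code_lt o').
by rewrite nth_glue_codes; apply: glue_code_in_port.
Qed.

Hypothesis A_clean : forall k e f, e \in A k -> f \in A k -> src e <> tgt f.
Hypothesis A_sorted : forall k,
  let key i := 4 * otype (output tau sig (E k) (inord i))
               + itype (input tau sig (E k) (inord i)) in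
  key 0 <= key 1 <= key 2.
Hypothesis A_pairs : forall k k', k != k' ->
  #|[set o : port 3 | [exists p, (out_port o == in_port p) &&
      ((o.1 == k) && (p.1 == k') || (o.1 == k') && (p.1 == k))]]| <= 2.
Hypothesis A_sat : 4 < #|[set o | [exists p, out_port o == in_port p]]|.

Lemma glue_codes_valid : valid_triple glue_codes.
Proof.
have sz : size glue_codes = 9 by rewrite !size_map size_iota.
have gle9 o : glue_code o <= 9.
  by case: (glue_codeP o) => [[p _ ->]|[_ ->]] //; apply: ltnW (code_lt p).
split=> //.
- move=> i; have [/code_decode[o ->]|i9] := ltnP i 9; first by rewrite nth_glue_codes.
  by rewrite nth_default ?sz.
- move=> i /code_decode[o ->]; rewrite nth_glue_codes.
  case: (glue_codeP o) => [[p Ep ->]|[_ ->]]; rewrite hex_of_code; last first.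
    by rewrite neq_ltn ltn_ord orbT.
  rewrite hex_of_code; apply/eqP => /val_inj Ek.
  apply: (A_clean (triple_arc_in (p, true)) (f := triple_arc (turn true o, false))).
    by rewrite /= Ek; apply: (triple_arc_in (turn true o, false)).
  by rewrite src_triple_arc -out_port_tgt Ep.
- move=> i j /andP[ij /[dup] /code_decode[o' Ej]].
  move=> j9; have [o Ei] := code_decode (ltn_trans ij j9).
  rewrite Ei Ej !nth_glue_codes.
  case: (glue_codeP o') => [[p Ep ->]|[_ ->]] // /glue_code_lt.
  by rewrite -Ep => /out_port_inj Eo; rewrite Ei Ej Eo ltnn in ij.
- have srt k i : i < 2 ->
      key glue_codes (3 * k + i) <= key glue_codes (3 * k + i.+1) \/ 3 <= k.
    move=> i2; have [k3|] := ltnP k 3; [left|by right].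
    have cE j : j < 3 -> 3 * k + j = code ((Ordinal k3, inord j) : port 3).
      by move=> j3; rewrite /code /= inordK.
    have i3 : i < 3 := ltnW i2; rewrite (cE i i3) (cE i.+1 i2) !key_code.
    have := A_sorted (Ordinal k3); rewrite /in_port /out_port /= => /andP[].
    by case: i i2 {i3} => [|[|//]].
  have s k i : k < 3 -> i < 2 ->
      key glue_codes (3 * k + i) <= key glue_codes (3 * k + i.+1).
    by move=> k3 i2; have [//|] := srt k i i2; rewrite leqNgt k3.
  rewrite /key_sorted /=.
  by rewrite (s 0 0) // (s 0 1) // (s 1 0) // (s 1 1) // (s 2 0) // (s 2 1).
- move=> k k' /andP[kk' k'3]; have k3 := ltn_trans kk' k'3.
  have ne : Ordinal k3 != Ordinal k'3 by rewrite -val_eqE /= neq_ltn kk'.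
  apply: leq_trans (A_pairs ne); rewrite /num_between sz -code_ports count_map count_ports.
  apply/subset_leq_card/subsetP => o oP; rewrite inE; move: oP.
  rewrite unfold_in /= nth_glue_codes hex_of_code.
  case: (glue_codeP o) => [[p Ep ->]|[_ ->]]; last first.
    by rewrite -[hex_of 9]/3 (gtn_eqF k3) (gtn_eqF k'3) !if_same.
  rewrite hex_of_code => h; apply/existsP; exists p; rewrite Ep eqxx.
  change (((o.1 : nat) == k) && ((p.1 : nat) == k')
    || ((o.1 : nat) == k') && ((p.1 : nat) == k)).
  by move: h; case: ifP => [_ ->|_] //=; case: ifP => [_ ->|].
- pose P := [pred o | 9 <= glue_code o].
  have -> : count (leq 9) glue_codes = #|P| by rewrite count_map count_ports.
  have cT : #|{: port 3}| = 9 by rewrite card_prod !card_ord.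
  have PS : #|[set o | [exists p, out_port o == in_port p]]| = #|[predC P]|.
    apply: eq_card => o; rewrite !inE.
    case: (glue_codeP o) => [[p Ep ->]|[no ->]].
      by rewrite leqNgt (code_lt p); apply/existsP; exists p; rewrite Ep.
    by rewrite leqnn; apply/existsP => -[p /eqP/no].
  have S := A_sat; rewrite PS in S.
  (* At least five of the nine output ports are glued. *)
  by rewrite -(leq_add2r #|[predC P]|) cardC cT -[9]/(4 + 5) leq_add2l.
Qed.

End Triple.

Lemma card_param N (T : finType) (B : {set T}) (f : 'I_N -> T) : injective f ->
  (forall x, x \in B <-> exists a, x = f a) -> #|B| = N.
Proof.
move=> f_inj Bf; rewrite -[RHS]card_ord -cardsT -(card_imset _ f_inj).
apply: eq_card => x; apply/idP/imsetP => [/Bf[a ->]|[a _ ->]]; first by exists a.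
by apply/Bf; exists a.
Qed.

Lemma inj_surj_bij (S T : finType) (f : S -> T) : injective f ->
  (forall y, exists x, y = f x) -> bijective f.
Proof.
move=> f_inj /fin_all_exists[g gP]; exists g => [x|y]; last by rewrite -gP.
by apply: f_inj; rewrite -gP.
Qed.

(** * Degrees in a digraph with a pairing and in its subgraphs *)

Section PairedDegrees.
Variables (D : digraph) (tau sig : darc D -> darc D).
Hypothesis pr : pairing tau sig.

Lemma saturatedP (v : D) :
  v \in saturated D <-> (exists e, tgt e = v) /\ exists e, src e = v.
Proof.
rewrite inE; split=> [/andP[/eqP i2 /eqP o2]|[[e te] [f sf]]].
  split.
    by have /card_gt0P[e] : 0 < indeg v by [rewrite i2]; rewrite inE => /eqP; exists e.
  by have /card_gt0P[e] : 0 < outdeg v by [rewrite o2]; rewrite inE => /eqP; exists e.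
by rewrite -{1}te -sf (indeg_tgt pr) (outdeg_src pr).
Qed.

Lemma exitsP (v : D) :
  v \in exits D <-> (exists e, tgt e = v) /\ forall e, src e <> v.
Proof.
rewrite inE; split=> [/andP[/eqP i2 /eqP o2]|[[e te] no]].
  split=> [|e se].
    by have /card_gt0P[e] : 0 < indeg v by [rewrite i2]; rewrite inE => /eqP; exists e.
  by move: o2; rewrite -se (outdeg_src pr).
by rewrite -{1}te (indeg_tgt pr) (outdeg_eq0 no).
Qed.

Variable E : {set darc D}.
Hypothesis E_closed : forall e, e \in E -> tau e \in E /\ sig e \in E.

Lemma induced_pairing : exists tauE sigE : darc (arc_induced E) -> darc (arc_induced E),
  pairing tauE sigE.
Proof.
pose tauE (e : darc (arc_induced E)) : darc (arc_induced E) := insubd e (tau (val e)).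
pose sigE (e : darc (arc_induced E)) : darc (arc_induced E) := insubd e (sig (val e)).
have tE e : val (tauE e) = tau (val e).
  by rewrite val_insubd (E_closed (valP e)).1.
have sE e : val (sigE e) = sig (val e).
  by rewrite val_insubd (E_closed (valP e)).2.
exists tauE, sigE; split=> e f.
  by rewrite -!(inj_eq val_inj) tE -(co_tgtE pr).
by rewrite -!(inj_eq val_inj) sE -(co_srcE pr).
Qed.

End PairedDegrees.

Section InducedDegrees.
Variables (D : digraph) (tau sig : darc D -> darc D).
Hypothesis pr : pairing tau sig.
Variable E : {set darc D}.
Hypothesis E_closed : forall e, e \in E -> tau e \in E /\ sig e \in E.

Lemma induced_tgt (v : arc_induced E) : (exists e, tgt e = v) <->
  exists2 e, e \in E & tgt e = val v.
Proof.
split=> [[e <-]|[e eE te]]; first by exists (val e); [apply: valP|].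
by exists (Sub e eE); apply: val_inj; rewrite /= te.
Qed.

Lemma induced_src (v : arc_induced E) : (exists e, src e = v) <->
  exists2 e, e \in E & src e = val v.
Proof.
split=> [[e <-]|[e eE te]]; first by exists (val e); [apply: valP|].
by exists (Sub e eE); apply: val_inj; rewrite /= te.
Qed.

Lemma induced_saturated (v : arc_induced E) : v \in saturated (arc_induced E) <->
  (exists2 e, e \in E & tgt e = val v) /\ exists2 e, e \in E & src e = val v.
Proof.
have [tauE [sigE prE]] := induced_pairing pr E_closed.
by rewrite (saturatedP prE) induced_tgt induced_src.
Qed.

Lemma induced_exits (v : arc_induced E) : v \in exits (arc_induced E) <->
  (exists2 e, e \in E & tgt e = val v) /\ forall e, e \in E -> src e <> val v.
Proof.
have [tauE [sigE prE]] := induced_pairing pr E_closed.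
rewrite (exitsP prE) induced_tgt; split=> -[te no]; split=> //.
  move=> e eE se.
  have /induced_src[f sf] : exists2 f, f \in E & src f = val v by exists e.
  exact: (no f).
move=> e se; have /induced_src[f fE sf] : exists f, src f = v by exists e.
exact: (no f).
Qed.

End InducedDegrees.

(** * A 2-dd as an assembly of three of its hexagons and their complement *)

Section Triple.
Variables (G : digraph) (tau sig : darc G -> darc G).
Hypotheses (G2 : is_2dd G) (pr : pairing tau sig) (hx : hexagonal tau sig).
Variable A : 'I_3 -> {set darc G}.
Hypotheses (A_inj : injective A) (A_AC : forall k, A k \in ACs G).
Variable E : 'I_3 -> darc G.
Hypothesis E_in : forall k, E k \in A k.
Local Notation in_port := (in_port tau sig E).
Local Notation out_port := (out_port tau sig E).
Local Notation triple_arc := (triple_arc tau sig E).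
Let F := [set A k | k : 'I_3].
Let H := complement F.

Lemma cover_triple_arc e : e \in cover F <-> exists x, e = triple_arc x.
Proof.
split=> [/bigcupP[B /imsetP[k _ ->]]|[x ->]].
  by case/(memA_triple_arc pr hx A_AC E_in) => i [b ->]; exists ((k, i), b).
apply/bigcupP; exists (A x.1.1); first by apply/imsetP; exists x.1.1.
exact: (triple_arc_in pr hx A_AC E_in).
Qed.

Lemma cover_src e p : src e = in_port p -> e \in cover F.
Proof.
move=> /(src_in_port pr hx A_AC E_in) ek; apply/bigcupP; exists (A p.1) => //.
by apply/imsetP; exists p.1.
Qed.

Lemma cover_tgt e o : tgt e = out_port o -> e \in cover F.
Proof.
move=> /(tgt_out_port pr hx A_AC E_in) ek; apply/bigcupP; exists (A o.1) => //.
by apply/imsetP; exists o.1.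
Qed.

(** Every arc lies in an alternating cycle, and two alternating cycles with a common arc
    coincide. *)
Lemma cover_complement e : (e \in cover (ACs G :\: F)) = (e \notin cover F).
Proof.
apply/bigcupP/idP => [[B]|eF].
  rewrite in_setD => /andP[BF BA] eB; apply: contra BF => /bigcupP[C CF eC].
  suff -> : B = C by [].
  have CA : C \in ACs G by case/imsetP: CF => k _ ->.
  by rewrite (AC_hexagon pr hx BA eB) (AC_hexagon pr hx CA eC).
exists [set f in hexagon tau sig e]; last by rewrite inE mem_hexagon.
rewrite in_setD (hexagon_AC pr hx) andbT; apply: contra eF => eF.
by apply/bigcupP; exists [set f in hexagon tau sig e] => //;
  rewrite inE mem_hexagon.
Qed.

Lemma cover_closed (K : {set {set darc G}}) e : K \subset ACs G ->
  e \in cover K -> tau e \in cover K /\ sig e \in cover K.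
Proof.
move=> /subsetP KA /bigcupP[B BK eB].
have [tB sB] := AC_closed pr (KA B BK) eB.
by split; apply/bigcupP; exists B.
Qed.

Lemma F_ACs : F \subset ACs G.
Proof. by apply/subsetP => _ /imsetP[k _ ->]. Qed.

Lemma arc_in v : exists e, tgt e = v :> G.
Proof. by have /(saturatedP pr)[] := G2 v. Qed.

Lemma arc_out v : exists e, src e = v :> G.
Proof. by have /(saturatedP pr)[] := G2 v. Qed.

Lemma complement_incident e : e \notin cover F ->
  incident (cover (ACs G :\: F)) (src e) /\ incident (cover (ACs G :\: F)) (tgt e).
Proof.
by rewrite -cover_complement => eH; split; apply/exists_inP; exists e;
  rewrite ?eqxx ?orbT.
Qed.

Section Plugged.
Variables (N : nat) (w : port 3 -> port 3 + 'I_N) (el : 'I_N -> port 3).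
Hypothesis pl : plugging w el.
Hypothesis w_inl : forall o p, w o = inl p -> out_port o = in_port p.
Hypothesis w_inr : forall o a, w o = inr a -> forall p, out_port o <> in_port p.
Hypothesis el_out : forall a o, out_port o <> in_port (el a).

Lemma triple_assembly : exists alpha beta : 'I_N -> H,
  boundary alpha beta /\
  @assembly 3 N H alpha beta w el G val in_port val triple_arc.
Proof.
have /fin_all_exists[oa oaP] := w_ext pl.
have inH e : e \notin cover F -> exists e' : darc H, val e' = e.
  by rewrite -cover_complement => eH; exists (Sub e eH).
have notF (e : darc H) : val e \notin cover F.
  by rewrite -cover_complement; apply: valP.
(* This output port is glued to no input port of the triple, so an arc that leaves it is outside [F]
   and puts it into the complement. The exits [beta] arise in the same way from arcs that enter a
   free input port. *)
have /fin_all_exists[alpha alphaP] (a : 'I_N) : exists x : H, val x = out_port (oa a).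
  have [e se] := arc_out (out_port (oa a)).
  have eF : e \notin cover F.
    apply/negP => /cover_triple_arc[x Ex]; apply: (w_inr (oaP a) (p := x.1)).
    by rewrite -se Ex (src_triple_arc pr).
  have [i1 _] := complement_incident eF.
  by rewrite -se; exists (Sub (src e) i1).
have /fin_all_exists[beta betaP] (a : 'I_N) : exists x : H, val x = in_port (el a).
  have [e te] := arc_in (in_port (el a)).
  have eF : e \notin cover F.
    apply/negP => /cover_triple_arc[x Ex]; apply: (el_out (a := a) (o := turn x.2 x.1)).
    by rewrite -te Ex (tgt_triple_arc pr hx).
  have [_ i1] := complement_incident eF.
  by rewrite -te; exists (Sub (tgt e) i1).
(* At an input port that is glued inside [F] all arcs belong to [F], so it is no vertex of the
   complement. *)
have ip_beta (x : H) p : val x = in_port p -> exists a, x = beta a.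
  move=> Ex; case: (w_or_el pl p) => [[a Ea]|[o /w_inl Eo]].
    by exists a; apply: val_inj; rewrite betaP -Ea.
  have /exists_inP[e] := valP x; rewrite cover_complement => eF /orP[] /eqP Ee.
    by rewrite (cover_src (p := p)) ?Ee in eF.
  by rewrite (cover_tgt (o := o)) ?Ee ?Eo in eF.
have op_alpha (x : H) o : val x = out_port o -> exists a, x = alpha a.
  move=> Ex; case Ew : (w o) => [p|a]; last first.
    exists a; apply: val_inj; rewrite alphaP Ex; congr out_port.
    by apply: (w_inj pl); rewrite Ew oaP.
  have /exists_inP[e] := valP x; rewrite cover_complement => eF /orP[] /eqP Ee.
    by rewrite (cover_src (p := p)) // -(w_inl Ew) Ee -Ex in eF.
  by rewrite (cover_tgt (o := o)) ?Ee -?Ex in eF.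
exists alpha, beta; split.
  split.
  - move=> a b /(congr1 val); rewrite !alphaP => /(out_port_inj pr hx A_inj A_AC E_in) Eo.
    by have := oaP a; rewrite Eo oaP => -[].
  - move=> a b /(congr1 val); rewrite !betaP.
    by move/(in_port_inj pr hx A_inj A_AC E_in)/(el_inj pl).
  - by move=> a b /(congr1 val); rewrite alphaP betaP; apply: el_out.
  - move=> a e /(congr1 val); rewrite alphaP => /cover_tgt eF.
    by have := notF e; rewrite eF.
  - move=> a e /(congr1 val); rewrite betaP => /cover_src eF.
    by have := notF e; rewrite eF.
  - move=> x; have [e te] := arc_in (val x).
    have [/cover_triple_arc[z Ez]|/inH[e' Ee]] := boolP (e \in cover F).
      by left; apply: (op_alpha _ (turn z.2 z.1)); rewrite -te Ez (tgt_triple_arc pr hx).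
    by right; exists e'; apply: val_inj; rewrite /= Ee te.
  - move=> x; have [e te] := arc_out (val x).
    have [/cover_triple_arc[z Ez]|/inH[e' Ee]] := boolP (e \in cover F).
      by left; apply: (ip_beta _ z.1); rewrite -te Ez (src_triple_arc pr).
    by right; exists e'; apply: val_inj; rewrite /= Ee te.
split=> //.
- apply: inj_surj_bij => [[e|x] [f|y] /=|e].
  + by move/val_inj->.
  + by move=> Ee; case/negP: (notF e); apply/cover_triple_arc; exists y.
  + by move=> Ee; case/negP: (notF f); apply/cover_triple_arc; exists x.
  + by move/(triple_arc_inj pr hx A_inj A_AC E_in) ->.
  have [/cover_triple_arc[z Ez]|/inH[e' Ee]] := boolP (e \in cover F).
    by exists (inr z).
  by exists (inl e').
- by move=> x; rewrite (src_triple_arc pr).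
- move=> x; rewrite (tgt_triple_arc pr hx) /exit_of; case Ew : (w _) => [p|a].
    exact: w_inl.
  by rewrite alphaP; congr out_port; apply: (w_inj pl); rewrite Ew oaP.
- exact: val_inj.
- exact: (in_port_inj pr hx A_inj A_AC E_in).
- move=> v; have [e se] := arc_out v.
  have [/cover_triple_arc[z Ez]|/inH[e' Ee]] := boolP (e \in cover F).
    by right; exists z.1; rewrite -se Ez (src_triple_arc pr).
  by left; exists (src e'); rewrite -se -Ee.
Qed.

Lemma triple_card_exits : #|exits (subdigraph F)| = N.
Proof.
have /fin_all_exists[oa oaP] := w_ext pl.
have clF := cover_closed F_ACs.
have inc e : e \in cover F -> incident (cover F) (tgt e).
  by move=> eF; apply/exists_inP; exists e; rewrite ?eqxx ?orbT.
have op_in o : exists2 e, e \in cover F & tgt e = out_port o.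
  have [e te] := arc_in (out_port o); exists e => //; exact: cover_tgt te.
have /fin_all_exists[g gP] (a : 'I_N) : exists x : subdigraph F, val x = out_port (oa a).
  have [e eF te] := op_in (oa a); rewrite -te.
  by exists (Sub (tgt e) (inc e eF)).
apply: (@card_param _ _ _ g) => [a b /(congr1 val)|x].
  rewrite !gP => /(out_port_inj pr hx A_inj A_AC E_in) Eo.
  by have := oaP a; rewrite Eo oaP => -[].
split=> [/(induced_exits pr clF)[[e /cover_triple_arc[z Ez] te] no]|[a ->]].
  have Ex : val x = out_port (turn z.2 z.1) by rewrite -te Ez (tgt_triple_arc pr hx).
  case Ew : (w (turn z.2 z.1)) => [p|a].
    have [f sf] := arc_out (in_port p); have := no f (cover_src sf).
    by rewrite Ex (w_inl Ew) sf.
  exists a; apply: val_inj; rewrite gP Ex; congr out_port.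
  by apply: (w_inj pl); rewrite Ew oaP.
apply/(induced_exits pr clF); rewrite gP; split=> [|e /cover_triple_arc[z ->]]; first exact: op_in.
rewrite (src_triple_arc pr) => Ez; exact: (w_inr (oaP a) (esym Ez)).
Qed.

End Plugged.

(** A saturated vertex of [F] has an arc of [F] coming in and one going out, so it is an output port
    glued to an input port. *)
Lemma card_glued :
  #|saturated (subdigraph F)| <= #|[set o | [exists p, out_port o == in_port p]]|.
Proof.
have clF := cover_closed F_ACs.
rewrite -(card_imset _ val_inj); set S := [set o | _].
apply: leq_trans (leq_imset_card out_port S); apply/subset_leq_card/subsetP.
move=> _ /imsetP[x /(induced_saturated pr clF)[[e eF te] [f fF sf]] ->].
case/cover_triple_arc: eF te => z ->; case/cover_triple_arc: fF sf => y ->.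
rewrite (tgt_triple_arc pr hx) (src_triple_arc pr) => te sf.
apply/imsetP; exists (turn z.2 z.1) => //; rewrite inE; apply/existsP; exists y.1.
by rewrite te sf.
Qed.

(** Gluings between two hexagons are distinct saturated vertices of their union, so the hypothesis
    on pairs bounds their number. *)
Lemma card_glued_pair k k' : #|[set o : port 3 | [exists p, (out_port o == in_port p) &&
      ((o.1 == k) && (p.1 == k') || (o.1 == k') && (p.1 == k))]]|
  <= #|saturated (subdigraph [set A k; A k'])|.
Proof.
set K := [set A k; A k']; set S := [set o | _].
have KA : K \subset ACs G by apply/subsetP => B /set2P[] ->.
have clK := cover_closed KA.
have out_port_inj := out_port_inj pr hx A_inj A_AC E_in.
rewrite -(card_imset _ out_port_inj) -[X in _ <= X](card_imset _ val_inj).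
apply/subset_leq_card/subsetP => _ /imsetP[o /[!inE] /existsP[p /andP[/eqP Eo ok]] ->].
have [Ko Kp] : A o.1 \in K /\ A p.1 \in K.
  by case/orP: ok => /andP[/eqP -> /eqP ->]; rewrite !inE !eqxx !orbT.
have [e te] := arc_in (out_port o); have [f sf] := arc_out (in_port p).
have eK : e \in cover K.
  by apply/bigcupP; exists (A o.1) => //; apply: (tgt_out_port pr hx A_AC E_in).
have fK : f \in cover K.
  by apply/bigcupP; exists (A p.1) => //; apply: (src_in_port pr hx A_AC E_in).
have inc : incident (cover K) (out_port o).
  by apply/exists_inP; exists e => //; rewrite te eqxx orbT.
apply/imsetP; exists (Sub (out_port o) inc : subdigraph K); last by rewrite SubK.
apply/(induced_saturated pr clK).
by rewrite SubK; split; [exists e|exists f; rewrite // Eo].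
Qed.

End Triple.

(** * From the list model back to the digraph *)

Lemma nth_ext_list lm j : j < size lm ->
  (nth 0 (ext_list lm) j < 9 -> nth 9 lm j = nth 0 (ext_list lm) j) /\
  (9 <= nth 0 (ext_list lm) j -> 9 <= nth 9 lm j).
Proof.
rewrite /ext_list; suff gen b : 9 <= b -> j < size lm ->
    (nth 0 (ext_from b lm) j < 9 -> nth 9 lm j = nth 0 (ext_from b lm) j) /\
    (9 <= nth 0 (ext_from b lm) j -> 9 <= nth 9 lm j) by exact: gen.
elim: lm b j => //= v l IH b [|j] b9 jl; case: ifP => v9 //=; try exact: IH.
- by split; lia.
- by apply: IH => //; apply: leqW.
Qed.

Lemma w_of_inl N lm o p : size lm = 9 ->
  @w_of 2 N (ext_list lm) o = inl p -> nth 9 lm (code o) = code p.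
Proof.
move=> sz; have lt : code o < size lm by rewrite sz (code_lt o).
rewrite /w_of; case: ifP => // lt9 [<-].
by rewrite (decodeK lt9) (nth_ext_list lt).1.
Qed.

Lemma w_of_inr N lm o a : size lm = 9 ->
  @w_of 2 N (ext_list lm) o = inr a -> 9 <= nth 9 lm (code o).
Proof.
move=> sz; have lt : code o < size lm by rewrite sz (code_lt o).
rewrite /w_of; case: ifP => // /negbT; rewrite -leqNgt => ge9 _.
exact: (nth_ext_list lt).2.
Qed.

Theorem proposition14 (G : digraph) (F : {set {set darc G}}) (s : nat)
  (G_2dd : is_2dd G) (G_clean : clean G) (G_hex : all_ACs_size G 6)
  (G_odd : odd_2dd G) (G_conn : connected G) (G_nsplit : ~ two_splittable G)
  (F_sub : is_subgraph F) (F_three : #|F| = 3)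
  (F_sat : #|saturated (subdigraph F)| = s)
  (F_pairs : ~ exists K : {set {set darc G}},
     [/\ is_subgraph K, K \subset F, #|K| = 2
       & 2 < #|saturated (subdigraph K)|])
  (s_gt4 : 4 < s) :
  exists G' : digraph,
    [/\ obtained_by_collapsing F G' \/
        (exists F' : digraph,
           [/\ #|ACs F'| = 1, all_ACs_size F' 6
             & obtained_by_replacing F F' G']) \/
        (exists F' : digraph,
           [/\ #|ACs F'| = 2, all_ACs_size F' 6
             & obtained_by_replacing F F' G']),
        odd_2dd G', all_ACs_size G' 6 & H_equivalent G G'].
Proof.
have [tau [sig pr]] := pairing_exists (is_2dd_2digraph G_2dd).
have hx := hexagonal_ACs pr G_hex.
pose A (k : 'I_3) : {set darc G} := enum_val (cast_ord (esym F_three) k).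
have A_inj : injective A by move=> k k' /enum_val_inj/cast_ord_inj.
have AF k : A k \in F by apply: enum_valP.
have A_AC k : A k \in ACs G by apply: (subsetP F_sub.2).
have EF : F = [set A k | k : 'I_3].
  apply/esym/eqP; rewrite eqEcard (card_imset _ A_inj) card_ord F_three leqnn andbT.
  by apply/subsetP => _ /imsetP[k _ ->].
(* The weights are those of [key]: 4 exceeds every hexagon number, including 3 for the context, so
   the order is lexicographic. *)
have /fin_all_exists2[E E_in E_sorted] k :=
  sorted_labels pr hx (fun v v' => 4 * otype A v' + itype A v) (A_AC k).
have gc_valid : valid_triple (glue_codes tau sig E).
  apply: (glue_codes_valid pr hx A_inj A_AC E_in) => //.
  - by move=> k e f; apply: G_clean.
  - move=> k k' ne; apply: leq_trans (card_glued_pair G_2dd pr hx A_inj A_AC E_in k k') _.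
    rewrite leqNgt; apply/negP => gt2; apply: F_pairs; exists [set A k; A k']; split=> //.
    + split; first by apply/set0Pn; exists (A k); rewrite !inE eqxx.
      by apply/subsetP => B /set2P[] ->.
    + by apply/subsetP => B /set2P[] ->.
    + by rewrite cards2 (inj_eq A_inj) ne.
  - apply: leq_trans (card_glued pr hx A_AC E_in).
    by rewrite -EF F_sat.
have [N [lw' [le' [ok ok' cov [y0 cov0]]]]] := tripleP gc_valid.
set lm := glue_codes tau sig E in gc_valid ok cov.
have sz := vt_size gc_valid.
set w := @w_of 2 N (ext_list lm) in cov; set el := @el_of 2 N (free_list lm) in cov.
set w' := @w_of 1 N lw' in cov cov0; set el' := @el_of 1 N le' in cov cov0.
have pl : plugging w el := @plug_okP 2 N _ _ ok.
have pl' : plugging w' el' := @plug_okP 1 N _ _ ok'.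
have w_inl o p : w o = inl p -> out_port tau sig E o = in_port tau sig E p.
  move/(w_of_inl sz); rewrite nth_glue_codes.
  exact: glue_code_lt.
have w_inr o a : w o = inr a -> forall p, out_port tau sig E o <> in_port tau sig E p.
  move/(w_of_inr sz); rewrite nth_glue_codes => ge9 p.
  move/(glue_code_in_port pr hx A_inj A_AC E_in) => Eg.
  by move: ge9; rewrite Eg leqNgt (code_lt p).
have el_out a o : out_port tau sig E o <> in_port tau sig E (el a).
  move/(glue_code_in_port pr hx A_inj A_AC E_in) => Eg.
  have : code (el a) \in free_list lm.
    rewrite (@elcodeE 2 N _ _ ok) mem_nth //.
    by have /and5P[_ /eqP -> _ _ _] := ok.
  rewrite mem_filter => /andP[/negP nin _]; apply: nin.
  by rewrite -Eg -nth_glue_codes mem_nth // sz (code_lt o).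
have [alpha [beta]] := triple_assembly G_2dd pr hx A_inj A_AC E_in pl w_inl w_inr el_out.
have cardN := triple_card_exits G_2dd pr hx A_inj A_AC E_in pl w_inl w_inr.
rewrite -EF in alpha beta cardN * => -[bd cl].
have [tauH [sigH prH]] : exists tauH sigH : darc (complement F) -> darc (complement F),
    pairing tauH sigH.
  apply: (induced_pairing pr) => e; apply: (cover_closed pr).
  exact: subsetDl.
have hxH := assembly_hexagonal_context bd prH pl cl pr hx.
(* The splice is a second assembly of the context of which [cl] makes [G] an assembly, with the pair
   in place of the triple. *)
have [b [b' [b_bij b'_bij [ih' [in_port' [ah' [ak' cl']]]]]]] := splice_assembly pl' bd prH.
exists (splice b b'); split.
- right; right; exists (hex_digraph w'); split.
  + exact: hex_card_ACs pl'.
  + exact: hex_size6 pl'.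
  split; first exact: hex_2digraph pl'.
    rewrite cardN; apply: (@card_param _ _ _ (@inr (port 2) 'I_N.+1)) => [a c []|v] //.
    exact: (hex_exits pl').
  by exists b, b'.
- have covered : exists y, covers w el y && covers w' el' y.
    by exists y0; rewrite cov cov0.
  exact: (transfer_odd bd prH hxH pl pl' cl cl' covered G_odd).
- have [tau' [sig' pr']] := pairing_exists (is_2dd_2digraph (assembly_2dd bd prH pl' cl')).
  exact: (hexagonal_size6 pr' (assembly_hexagonal bd prH pl' cl' pr' hxH)).
- have cov_le y : covers w el y -> covers w' el' y by rewrite cov.
  have cov_ge y : covers w' el' y -> covers w el y by rewrite cov.
  split; first exact: (transfer_hamiltonian bd prH pl pl' cl cl' isT cov_le).
  exact: (transfer_hamiltonian bd prH pl' pl cl' cl isT cov_ge).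
Qed.
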